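(* Consider the generalized vertex algebra $V_L$ of the lattice $L=\mathbb Z(\gamma+\delta)+\mathbb Z(\gamma-\delta)$ as a weak $L(-\frac43\Lambda_0)$-module, hence as a $\hat{\mathfrak g}$-module of level $-\frac43$, via the vectors $e=e^{3(\gamma-\delta)}$, $h=4\delta(-1)$, $f=-\frac29Qe^{3(\gamma+\delta)}$. For every $s\in\mathbb Z$: (1) $U(\hat{\mathfrak g}).e^{2s\delta}\cong\pi_{-s}\bigl(L(-\tfrac43\Lambda_0)\bigr)$; (2) $U(\hat{\mathfrak g}).e^{-\gamma+(2s+1)\delta}\cong\pi_{-s}\bigl(L(-\tfrac23\Lambda_0-\tfrac23\Lambda_1)\bigr)$.
   Context: Affine side. $\mathfrak g=sl_2(\mathbb C)$ with basis $e,f,h$, $[h,e]=2e$, $[h,f]=-2f$, $[e,f]=h$, and form $(e,f)=1$, $(h,h)=2$. $\hat{\mathfrak g}=\mathfrak g\otimes\mathbb C[t,t^{-1}]\oplus\mathbb Cc\oplus\mathbb Cd$ is the affine Lie algebra of type $A_1^{(1)}$, $[x(n),y(m)]=[x,y](n+m)+n(x,y)\delta_{n+m,0}c$, where $x(n)=x\otimes t^n$; $\Lambda_0,\Lambda_1$ are its fundamental weights and $L(\lambda)$ is the irreducible highest weight $\hat{\mathfrak g}$-module with highest weight $\lambda$ (for $\lambda=a\Lambda_0+b\Lambda_1$ the level is $a+b$ and $h(0)$ acts on the highest weight vector by $b$). $L(k\Lambda_0)$ is the simple quotient of the universal affine vertex operator algebra $N(k\Lambda_0)$ of level $k$. A weak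 module is a module for the vertex algebra with no grading assumption. $L(-\frac43\Lambda_0)$ and $L(-\frac23\Lambda_0-\frac23\Lambda_1)$ are modules for the vertex operator algebra $L(-\frac43\Lambda_0)$. Twisting functor $\pi_s$. For $s\in\mathbb Z$ and a weak $L(k\Lambda_0)$-module $(M,Y_M)$, $\pi_s(M)$ is the weak $L(k\Lambda_0)$-module with the same underlying space and vertex operators $Y_M(\Delta_s(z)\,\cdot\,,z)$, where $\Delta_s(z)=z^{H^s(0)}\exp\bigl(\sum_{n\ge1}\frac{H^s(n)}{-n}(-z)^{-n}\bigr)$, $H^s=-s\frac h2$. Equivalently, on $\pi_s(M)$ the elements $e(n),f(n),h(n)$ act as $e(n-s)$, $f(n+s)$, $h(n)-sk\delta_{n,0}$ act on $M$. Lattice side. $\widetilde L=\mathbb Z\gamma+\mathbb Z\delta$ with $\langle\gamma,\gamma\rangle=-\langle\delta,\delta\rangle=\frac16$, $\langle\gamma,\delta\rangle=0$; $\mathfrak h=\mathbb C\otimes_{\mathbb Z}\widetilde L$, $\hat{\mathfrak h}=\mathfrak h\otimes\mathbb C[t,t^{-1}]\oplus\mathbb Cc$, $\alpha(n)=\alpha\otimes t^n$, and $M(1)$ is the level $1$ Heisenberg vertex algebra (Fock space of $\hat{\mathfrak h}$ with zero highest weight). $V_{\widetilde L}=M(1)\otimes\mathbb C[\widetilde L]$ is the generalized vertex algebra of the rational lattice $\widetilde L$ (Dong–Lepowsky), where $\mathbb C[\widetilde L]$ is the group algebra with basis $e^\alpha$, $\alpha(0)e^\beta=\langle\alpha,\beta\rangle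 e^\beta$, and $$Y(e^\alpha,z)=\exp\Bigl(\sum_{n\ge1}\tfrac{\alpha(-n)}{n}z^n\Bigr)\exp\Bigl(-\sum_{n\ge1}\tfrac{\alpha(n)}{n}z^{-n}\Bigr)e^\alpha z^{\alpha(0)},$$ extended to $M(1)\otimes e^\alpha$ by the usual normal ordered products. Write $Y(v,z)=\sum_{s\in\frac16\mathbb Z}v_sz^{-s-1}$. $V_L=M(1)\otimes\mathbb C[L]\subset V_{\widetilde L}$. $Q=e^{-6\gamma}_0$. Set $e=e^{3(\gamma-\delta)}$, $h=4\delta(-1)\mathbf 1$, $f=-\frac29Qe^{3(\gamma+\delta)}=-(4\gamma(-1)^2-\frac23\gamma(-2))e^{-3(\gamma-\delta)}$. These vectors generate a subalgebra of $V_L$ isomorphic to the vertex operator algebra $L(-\frac43\Lambda_0)$, and $V_L$ is a weak $L(-\frac43\Lambda_0)$-module; $\hat{\mathfrak g}$ acts on $V_L$ at level $-\frac43$ by $a(n)=a_n$ for $a\in\{e,f,h\}$. The isomorphisms are of weak $L(-\frac43\Lambda_0)$-modules. *)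

(* Defs.v *)
From HB Require Import structures.
From mathcomp Require Import all_boot all_order all_algebra.
From mathcomp Require Import finmap multiset.
From mathcomp Require Import boolp classical_sets functions fsbigop reals.
From mathcomp.multinomials Require Import monalg.

Set Implicit Arguments.
Unset Strict Implicit.
Unset Printing Implicit Defensive.
Import Order.TTheory GRing.Theory Num.Theory.
Local Open Scope classical_set_scope.
Local Open Scope ring_scope.

(** All infinite sums below are finitely supported sums [\sum_(i \in A) F i]
    of [fsbigop]: each of them is locally finite, either because of the
    truncation axiom of modules or because of the grading of the Fock space
    or of L(k Lambda_0). *)

(** ** Coefficients of exponentials of formal series of operators *)

Section ExpCoef.
Variables (F : fieldType) (V : lmodType F).

(* Coefficient of z^m in (\sum_(n >= 1) (x n) z^n)^k, applied to v. *)
Fixpoint pow_coef (x : nat -> V -> V) (k m : nat) (v : V) : V :=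
  if k is k'.+1
  then \sum_(i < m.+1 | (0 < i)%N) x i (pow_coef x k' (m - i)%N v)
  else if m == 0%N then v else 0.

(* Coefficient of z^m in exp (\sum_(n >= 1) (x n) z^n), applied to v; the
   k-th power has no term of degree below k. *)
Definition exp_coef (x : nat -> V -> V) (m : nat) (v : V) : V :=
  \sum_(k < m.+1) (k`!%:R)^-1 *: pow_coef x k m v.

End ExpCoef.

(* Binomial coefficient with an arbitrary integer on top. *)
Definition binz (F : fieldType) (m : int) (i : nat) : F :=
  (\prod_(j < i) (m%:~R - j%:R)) / i`!%:R.

(** ** Vertex algebras and weak modules

    [Y a n x] is the mode a_n x, where Y(a, z) = \sum_n a_n z^(-n-1). *)

Section VertexAlgebra.
Variable F : fieldType.

Section Modules.
Variables (V M : lmodType F) (vac : V).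
Variables (p : V -> int -> V -> V) (Y : V -> int -> M -> M).

(* Component form of the Jacobi identity. *)
Definition borcherds : Prop := forall (a b : V) (x : M) (l m n : int),
  \sum_(i \in [set: nat]) binz F m i *: Y (p a (l + i%:Z) b) (m + n - i%:Z) x
  = \sum_(i \in [set: nat]) ((-1) ^+ i * binz F l i) *:
      (Y a (m + l - i%:Z) (Y b (n + i%:Z) x)
       - (-1) ^ l *: Y b (n + l - i%:Z) (Y a (m + i%:Z) x)).

Definition module_axioms : Prop :=
  [/\ forall n x, linear (fun a => Y a n x),
      forall a n, linear (Y a n),
      forall a x, exists N : int, forall n, N <= n -> Y a n x = 0,
      forall n x, Y vac n x = if n == -1 then x else 0
    & borcherds].

End Modules.

Record vertex_algebra := VertexAlgebra {
  va_sort :> lmodType F;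
  va_vac : va_sort;
  va_prod : va_sort -> int -> va_sort -> va_sort;
  va_module : module_axioms va_vac va_prod va_prod;
  va_creation : forall a : va_sort, va_prod a (-1) va_vac = a
    /\ forall n : int, 0 <= n -> va_prod a n va_vac = 0 }.

(* No grading is assumed. *)
Definition weak_module (V : vertex_algebra) (M : lmodType F)
    (Y : V -> int -> M -> M) : Prop :=
  module_axioms (va_vac V) (@va_prod V) Y.

End VertexAlgebra.

Arguments va_vac {F} v.
Arguments va_prod {F v} a n x.
Arguments weak_module {F} V {M} Y.

(** ** The affine Lie algebra of type A_1^(1) and its modules *)

Inductive sl2_basis := sl_e | sl_f | sl_h.

(* The bracket of two basis vectors is a multiple of a basis vector. *)
Definition sl2_bracket (x y : sl2_basis) : int * sl2_basis :=
  match x, y with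
  | sl_e, sl_f => (1, sl_h)
  | sl_f, sl_e => (-1, sl_h)
  | sl_h, sl_e => (2, sl_e)
  | sl_e, sl_h => (-2, sl_e)
  | sl_h, sl_f => (-2, sl_f)
  | sl_f, sl_h => (2, sl_f)
  | _, _ => (0, sl_h)
  end.

Definition sl2_form (x y : sl2_basis) : int :=
  match x, y with
  | sl_e, sl_f | sl_f, sl_e => 1
  | sl_h, sl_h => 2
  | _, _ => 0
  end.

Section Affine.
Variables (F : fieldType) (M : lmodType F).
Implicit Types (act : sl2_basis -> int -> M -> M) (c d : M -> M).

(* [act x n], [c] and [d] are the actions of x(n), c and d. *)
Definition affine_rep act c d : Prop :=
  [/\ (forall x n, linear (act x n)) /\ linear c /\ linear d,
      forall x y m n v,
        act x n (act y m v) - act y m (act x n v)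
        = (sl2_bracket x y).1%:~R *: act (sl2_bracket x y).2 (n + m) v
          + (if n + m == 0 then (n * sl2_form x y)%:~R *: c v else 0),
      forall x n v, c (act x n v) = act x n (c v),
      forall v, d (c v) = c (d v)
    & forall x n v, d (act x n v) - act x n (d v) = n%:~R *: act x n v].

Definition submodule act (P : set M) : Prop :=
  [/\ P 0, forall (a : F) u v, P u -> P v -> P (a *: u + v)
    & forall x n v, P v -> P (act x n v)].

(* U(g^).v, for an action on which c is a scalar. *)
Definition affine_span act (v : M) : set M := smallest (submodule act) [set v].

Definition affine_irreducible act c d : Prop :=
  forall P : set M, submodule act P ->
    (forall v, P v -> P (c v)) -> (forall v, P v -> P (d v)) ->
    P = [set 0] \/ P = [set: M].

(* The highest weight is a Lambda_0 + b Lambda_1; it vanishes on d. *)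
Definition highest_weight_vector (a b : F) act c d (v : M) : Prop :=
  [/\ v != 0,
      act sl_e 0 v = 0 /\ (forall x (n : int), 0 < n -> act x n v = 0),
      act sl_h 0 v = b *: v,
      c v = (a + b) *: v
    & d v = 0].

(* [M] is L(a Lambda_0 + b Lambda_1), with highest weight vector [v].  Only the
   e(n), f(n), h(n) are visible to a weak module over a vertex algebra, so c and
   d are existentially quantified. *)
Definition is_irreducible_hw (a b : F) act (v : M) : Prop :=
  exists c d, [/\ affine_rep act c d, affine_irreducible act c d
                & highest_weight_vector a b act c d v].

End Affine.

Section AffineVOA.
Variable F : fieldType.

Definition modes (V : vertex_algebra F) (M : lmodType F)
    (g : sl2_basis -> V) (Y : V -> int -> M -> M) : sl2_basis -> int -> M -> M :=
  fun x n => Y (g x) n.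

(* [V] is the vertex algebra L(k Lambda_0), with x(-1)1 = g x for x = e, f, h:
   the quotient of N(k Lambda_0) by its maximal proper g^-submodule, whose
   vertex operators are determined by Y(x(-1)1, z) = \sum_n x(n) z^(-n-1). *)
Definition is_affine_VOA (k : F) (V : vertex_algebra F) (g : sl2_basis -> V)
    : Prop :=
  is_irreducible_hw k 0 (modes g (@va_prod F V)) (va_vac V).

(* The weak module [Y] over L(k Lambda_0) is L(a Lambda_0 + b Lambda_1). *)
Definition is_affine_module (a b : F) (V : vertex_algebra F)
    (g : sl2_basis -> V) (M : lmodType F) (Y : V -> int -> M -> M) : Prop :=
  weak_module V Y /\ exists v : M, is_irreducible_hw a b (modes g Y) v.

(** ** The twisting functor pi_s *)

Section Twist.
Variables (V : vertex_algebra F) (g : sl2_basis -> V) (s : int).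

(* H^s = - s h / 2 *)
Definition twistH : V := - (s%:~R / 2) *: g sl_h.

(* Coefficient of z^(-m) in exp (\sum_(n >= 1) H^s(n) / (-n) (-z)^(-n)) a. *)
Definition Delta_coef (m : nat) (a : V) : V :=
  exp_coef (fun n b => ((-1) ^+ n / - n%:R) *: va_prod twistH n%:Z b) m a.

(* [Ys] is the module structure of pi_s (M, Y), i.e. Ys(a, z) = Y(Delta_s(z) a, z).
   It is spelled out on the eigenvectors of H^s(0), which span V; on those
   z^(H^s(0)) a = z^j a, and H^s(0) commutes with all H^s(n). *)
Definition is_pi (M : lmodType F) (Y Ys : V -> int -> M -> M) : Prop :=
  weak_module V Ys /\
  forall (a : V) (j : int), va_prod twistH 0 a = j%:~R *: a ->
  forall (n : int) (x : M),
    Ys a n x = \sum_(m \in [set: nat]) Y (Delta_coef m a) (n + j - m%:Z) x.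

End Twist.

(* The weak module [Y1] on M1 is isomorphic to the submodule [U] of the weak
   module [Y2] on M2. *)
Definition weak_iso_onto (V : vertex_algebra F) (M1 M2 : lmodType F)
    (Y1 : V -> int -> M1 -> M1) (Y2 : V -> int -> M2 -> M2) (U : set M2) : Prop :=
  exists phi : {linear M1 -> M2},
    [/\ injective phi, range phi = U
      & forall a n x, phi (Y1 a n x) = Y2 a n (phi x)].

End AffineVOA.

(** ** The generalized vertex algebra V_L *)

(* (p, q) stands for p (gamma + delta) + q (gamma - delta). *)
Definition lat := (int * int)%type.

(* In M(1), [false] stands for gamma and [true] for delta. *)
Definition lat_coord (x : lat) (b : bool) : int :=
  if b then x.1 - x.2 else x.1 + x.2.

(* <gamma, gamma> = 1/6, <delta, delta> = -1/6, <gamma, delta> = 0 *)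
Definition hnorm (K : fieldType) (b : bool) : K := (-1) ^+ b / 6.

Definition lat_form (x y : lat) : rat :=
  \sum_(b : bool) hnorm rat b * (lat_coord x b * lat_coord y b)%:~R.

Definition lat_2s_delta (s : int) : lat := (s, - s).
Definition lat_mgamma_2s1_delta (s : int) : lat := (s, - s - 1).

Lemma lat_2s_deltaE (s : int) :
  lat_coord (lat_2s_delta s) false = 0 /\
  lat_coord (lat_2s_delta s) true = 2 * s.
Proof. by rewrite /lat_coord /= subrr opprK mulr_natl mulr2n. Qed.

Lemma lat_mgamma_2s1_deltaE (s : int) :
  lat_coord (lat_mgamma_2s1_delta s) false = -1 /\
  lat_coord (lat_mgamma_2s1_delta s) true = 2 * s + 1.
Proof.
rewrite /lat_coord /= addrA subrr add0r; split=> //.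
by rewrite opprD !opprK addrA mulr_natl mulr2n.
Qed.

(* A basis of M(1) (x) C[L]: the pair (u, beta) is the product of the
   gamma(-n-1), resp. delta(-n-1), for (false, n), resp. (true, n), in the
   multiset u, times e^beta. *)
Definition fock_index : choiceType := ({mset (bool * nat)%type}%mset * lat)%type.

Section Lattice.
Variable F : fieldType.

Definition VL : lmodType F := {malg F[fock_index]}.

Implicit Types (u : {mset (bool * nat)%type}%mset) (x y al be : lat).

Definition fock_vec u be : VL := << 1 *g ((u, be) : fock_index) >>.

Definition expL be : VL := fock_vec mset0%mset be.

Definition lin_ext (E : fock_index -> VL) (v : VL) : VL :=
  \sum_(i <- msupp v) v@_i *: E i.

(* gamma(n) and delta(n) *)
Definition heis (b : bool) (n : int) : VL -> VL :=
  lin_ext (fun i : fock_index => match n with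
    | Negz m => fock_vec ((b, m) +` i.1)%mset i.2
    | Posz 0 => (hnorm F b * (lat_coord i.2 b)%:~R) *: fock_vec i.1 i.2
    | Posz m.+1 => (m.+1%:R * hnorm F b * (i.1 (b, m))%:R) *:
                     fock_vec (i.1 `\ (b, m))%mset i.2
    end).

(* al(n), for al in L *)
Definition lat_heis al (n : int) (v : VL) : VL :=
  \sum_(b : bool) (lat_coord al b)%:~R *: heis b n v.

(* Coefficient of z^i in exp (\sum_(n >= 1) al(-n) z^n / n). *)
Definition exp_minus al (i : nat) (v : VL) : VL :=
  exp_coef (fun n w => n%:R^-1 *: lat_heis al (- n%:Z) w) i v.

(* Coefficient of z^(-j) in exp (- \sum_(n >= 1) al(n) z^(-n) / n). *)
Definition exp_plus al (j : nat) (v : VL) : VL :=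
  exp_coef (fun n w => - n%:R^-1 *: lat_heis al n%:Z w) j v.

(* (e^al)_r, the coefficient of z^(-r-1) in Y(e^al, z): since
   e^al z^(al(0)) (u, be) = z^<al, be> (u, al + be), the term
   (exp_minus i) (exp_plus j) comes with z^(i - j + <al, be>). *)
Definition Yexp al (r : rat) : VL -> VL :=
  lin_ext (fun i : fock_index =>
    \sum_(p \in [set p : nat * nat |
                 p.1%:R - p.2%:R + lat_form al i.2 = - r - 1])
      exp_minus al p.1 (exp_plus al p.2 (fock_vec i.1 (al + i.2)))).

(* Coefficient of z^(-r-1) in the normal ordered product
   : (d/dz)^m b(z) / m! W(z) :, where b(z) = \sum_k b(k) z^(-k-1) is gamma(z) or
   delta(z) and W(z) = \sum_t W_t z^(-t-1). *)
Definition normal_prod (bm : bool * nat) (W : rat -> VL -> VL)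
    (r : rat) (v : VL) : VL :=
  let t (k : int) : rat := r - k%:~R - 1 - bm.2%:R in
  \sum_(k \in [set: int]) binz F (- k - 1) bm.2 *:
    (if k < 0 then heis bm.1 k (W (t k) v) else W (t k) (heis bm.1 k v)).

(* v_r, where Y(v, z) = \sum_r v_r z^(-r-1) *)
Definition YL (v : VL) (r : rat) (w : VL) : VL :=
  \sum_(i <- msupp v) v@_i *:
    foldr normal_prod (Yexp i.2) (enum_mset i.1) r w.

(* Q = (e^(-6 gamma))_0, with -6 gamma = -3 (gamma + delta) - 3 (gamma - delta) *)
Definition QL : VL -> VL := YL (expL (-3, -3)) 0.

Definition sl2_vec (x : sl2_basis) : VL :=
  match x with
  | sl_e => expL (0, 3)
  | sl_f => - (2 / 9) *: QL (expL (3, 0))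
  | sl_h => 4 *: heis true (-1) (expL 0)
  end.

Definition VL_act (x : sl2_basis) (n : int) : VL -> VL :=
  YL (sl2_vec x) n%:~R.

End Lattice.

(* Main.v *)
(** Let w be the vector e^{2 s delta}, resp. e^{-gamma + (2s+1) delta}.  Twist
    the action of g^ on V_L by pi_s: then w becomes a highest weight vector of
    weight k Lambda_0, resp. -2/3 Lambda_0 - 2/3 Lambda_1.  If v is a highest
    weight vector of the given irreducible module N of that weight, the span of
    (v, w) in the direct sum of N and V_L is the graph of an isomorphism from N
    onto the span of w as soon as the latter is simple; as e, f and h generate
    L(k Lambda_0), it commutes with all vertex operators.  For simplicity, the
    modes e(n), n >= 0, and h(n), n > 0, of the twisted action bring any nonzero
    vector of the span of w down to a nonzero multiple of w times some
    e^{3j (gamma - delta)}, because a vector killed by all of them is killed by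
    all the Heisenberg modes of positive index.  From there e(-1), if j < 0, and
    f(1), if j > 0, lead to w: f(1) multiplies e^{m gamma + n delta} by
    e^{-3 (gamma - delta)} and a nonzero multiple of m (m + 1). *)

From HB Require Import structures.
Require Import Defs.
From mathcomp Require Import all_boot all_order all_algebra.
From mathcomp Require Import finmap multiset.
From mathcomp Require Import boolp classical_sets functions fsbigop.
From mathcomp Require Import reals complex.
From mathcomp.multinomials Require Import monalg.
From mathcomp Require Import ring zify.

Set Implicit Arguments.
Unset Strict Implicit.
Unset Printing Implicit Defensive.
Import Order.TTheory GRing.Theory Num.Theory.
Local Open Scope classical_set_scope.
Local Open Scope ring_scope.

(** * Linear algebra *)

Section LinearFun.
Variables (F : fieldType) (M N : lmodType F) (f : M -> N).
Hypothesis lin_f : linear f.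

Lemma linear_fun0 : f 0 = 0.
Proof. by have := lin_f (-1) 0 0; rewrite scaler0 addr0 scaleN1r addNr. Qed.

Lemma linear_funD : {morph f : u v / u + v}.
Proof. by move=> u v; have := lin_f 1 u v; rewrite !scale1r. Qed.

Lemma linear_funZ a : {morph f : u / a *: u}.
Proof. by move=> u; have := lin_f a u 0; rewrite !addr0 linear_fun0 addr0. Qed.

Lemma linear_funN : {morph f : u / - u}.
Proof. by move=> u; rewrite -scaleN1r linear_funZ scaleN1r. Qed.

Lemma linear_funB : {morph f : u v / u - v}.
Proof. by move=> u v; rewrite linear_funD linear_funN. Qed.

End LinearFun.

Lemma addr_eq (V : zmodType) (a b c d : V) : a = b -> c = d -> a + c = b + d.
Proof. by move=> -> ->. Qed.

Lemma scaler_eq (F : fieldType) (V : lmodType F) (a b : F) (v : V) :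
  a = b -> a *: v = b *: v.
Proof. by move=> ->. Qed.

(* [f] preserves the support; if it is infinite, both sums are the junk value 0. *)
Lemma linear_fsum (F : fieldType) (M N : lmodType F) (f : {linear M -> N}) (I : choiceType)
    (A : set I) (G : I -> M) : injective f ->
  f (\sum_(i \in A) G i) = \sum_(i \in A) f (G i).
Proof.
move=> inj_f.
suff E : A `&` (fun i => f (G i)) @^-1` [set~ 0] = A `&` G @^-1` [set~ 0].
  by rewrite linear_sum /finite_support !unlock E.
apply/seteqP; split=> i [Ai /= nz]; split=> //=; apply: contra_not nz.
  by move=> ->; exact: linear0.
by rewrite -(linear0 f) => /inj_f.
Qed.

Lemma scaler_fsumr (F : fieldType) (V : lmodType F) (c : F) (I : choiceType)
    (A : set I) (G : I -> V) :
  c *: (\sum_(i \in A) G i) = \sum_(i \in A) c *: G i.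
Proof.
have [->|c0] := eqVneq c 0.
  by rewrite scale0r fsbig1 // => i _; rewrite scale0r.
by rewrite (linear_fsum (f := *:%R c)) //=; exact: scalerI.
Qed.

Definition subspace (F : fieldType) (M : lmodType F) (P : set M) : Prop :=
  P 0 /\ forall (a : F) u v, P u -> P v -> P (a *: u + v).

Section Subspace.
Variables (F : fieldType) (M : lmodType F) (P : set M).
Hypothesis subP : subspace P.

Lemma subspaceZ a u : P u -> P (a *: u).
Proof. by case: subP => P0 PL Pu; have := PL a u 0 Pu P0; rewrite addr0. Qed.

Lemma subspaceD u v : P u -> P v -> P (u + v).
Proof. by case: subP => P0 PL Pu Pv; have := PL 1 u v Pu Pv; rewrite scale1r. Qed.

Lemma subspaceB u v : P u -> P v -> P (u - v).
Proof. by move=> Pu Pv; rewrite -scaleN1r; apply/subspaceD/subspaceZ. Qed.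

Lemma subspace_sum (I : eqType) (r : seq I) (Q : pred I) (G : I -> M) :
  (forall i, i \in r -> Q i -> P (G i)) -> P (\sum_(i <- r | Q i) G i).
Proof.
move=> PG; rewrite big_seq_cond; apply: big_ind => [|u v|i /andP[]]; last exact: PG.
  exact: subP.1.
exact: subspaceD.
Qed.

Lemma subspace_fsum (I : choiceType) (A : set I) (G : I -> M) :
  (forall i, A i -> P (G i)) -> P (\sum_(i \in A) G i).
Proof.
move=> PG; apply: subspace_sum => i + _; case: finite_supportP => // X XA _ _.
by move=> /XA /PG.
Qed.

End Subspace.

Lemma submodule_subspace (F : fieldType) (M : lmodType F) act (P : set M) :
  submodule act P -> subspace P.
Proof. by case. Qed.

(** * Highest weight modules *)

Section AffineSpan.
Variables (F : fieldType) (M : lmodType F) (act : sl2_basis -> int -> M -> M).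

Lemma affine_span_gen v : affine_span act v v.
Proof. by move=> P [_]; apply. Qed.

Lemma affine_span_submodule v : submodule act (affine_span act v).
Proof.
split=> [P [[]]//|a u w Su Sw P SP|x n u Su P SP].
  by case: (SP) => -[_ PL _] _; exact: PL (Su P SP) (Sw P SP).
by case: (SP) => -[_ _ Pact] _; exact: Pact (Su P SP).
Qed.

Lemma affine_span_min v (P : set M) :
  submodule act P -> P v -> affine_span act v `<=` P.
Proof. by move=> subP Pv u; apply; split => // _ ->. Qed.

End AffineSpan.

Section HighestWeight.
Variables (F : fieldType) (M : lmodType F).
Variables (act : sl2_basis -> int -> M -> M) (c d : M -> M).
Hypothesis rep : affine_rep act c d.

(** The elements of the span whose image under [d] stays in the span form a submodule, because
    [d, x(n)] = n x(n). *)
Lemma affine_span_d v : d v = 0 -> forall u,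
  affine_span act v u -> affine_span act v (d u).
Proof.
case: rep => [[lact [lc ld]]] _ _ _ dcomm dv0 u Su.
have subS := affine_span_submodule act v; have sS := submodule_subspace subS.
suff /(_ u Su)[] : affine_span act v `<=`
  [set x | affine_span act v x /\ affine_span act v (d x)] by [].
apply: affine_span_min; last first.
  by split; [exact: affine_span_gen|rewrite dv0; exact: sS.1].
split=> [|a x y [Sx Sdx] [Sy Sdy]|x n y [Sy Sdy]] /=.
- by rewrite (linear_fun0 ld); split; exact: sS.1.
- by rewrite ld; split; apply: sS.2.
- case: (subS) => _ _ Sact; split; first exact: Sact.
  have /eqP := dcomm x n y; rewrite subr_eq addrC => /eqP ->.
  by apply: (subspaceD sS); [exact: Sact|apply: (subspaceZ sS); exact: Sact].
Qed.

Variables (a b : F) (v : M).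
Hypotheses (irr : affine_irreducible act c d)
  (hw : highest_weight_vector a b act c d v).

Lemma irreducible_full (P : set M) : submodule act P ->
    (forall u, P u -> P (c u)) -> (forall u, P u -> P (d u)) -> P v ->
  forall u, P u.
Proof.
case: hw => /eqP vN0 _ _ _ _ subP cP dP Pv u.
have [eqP|->//] := irr subP cP dP.
by move: Pv; rewrite eqP => /vN0.
Qed.

(** As [c] is central, its eigenspace through [v] is stable under the whole algebra. *)
Lemma irreducible_hw_c u : c u = (a + b) *: u.
Proof.
case: rep => [[lact [lc ld]]] _ cact cd _; case: hw => _ _ _ cv _.
apply: (irreducible_full (P := [set u | c u = (a + b) *: u])) u => //=.
- split=> [|t x y cx cy|x n y cy] /=; first by rewrite (linear_fun0 lc) scaler0.
    by rewrite lc cx cy scalerDr !scalerA mulrC.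
  by rewrite cact cy (linear_funZ (lact _ _)).
- by move=> x cx; rewrite cx (linear_funZ lc) cx.
- by move=> x cx; rewrite -cd cx (linear_funZ ld).
Qed.

Lemma irreducible_hw_span : affine_span act v = [set: M].
Proof.
have subS := affine_span_submodule act v; have sS := submodule_subspace subS.
rewrite -subTset => u _.
apply: (irreducible_full subS) => [x Sx||]; last exact: affine_span_gen.
  by rewrite irreducible_hw_c; exact: (subspaceZ sS).
by case: hw => _ _ _ _ dv0; exact: affine_span_d.
Qed.

End HighestWeight.

(** The grading in which both Chevalley generators e(0) and f(1) of n_+ have degree 1. *)
Definition principal_degree (x : sl2_basis) (n : int) : int :=
  match x with sl_e => 2 * n + 1 | sl_f => 2 * n - 1 | sl_h => 2 * n end.

(** * Weights in the span of a highest weight vector *)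

Section PrincipalGrading.
Variables (F : numFieldType) (M : lmodType F).
Variables (act : sl2_basis -> int -> M -> M) (a b : F) (d : M -> M) (v : M).
Hypotheses (rep : affine_rep act ( *:%R (a + b)) d)
  (hw : highest_weight_vector a b act ( *:%R (a + b)) d v).

(* The principal grading operator: [n_-] has negative degree and [n_+] positive degree. *)
Definition principal (u : M) : M := 2 *: d u + 2^-1 *: act sl_h 0 u.

Let lact x n : linear (act x n).
Proof. by case: rep => -[]. Qed.

Let ld : linear d.
Proof. by case: rep => -[_ []]. Qed.

Lemma principal_linear : linear principal.
Proof.
move=> t x y; rewrite /principal ld lact !scalerDr !scalerA.
by rewrite ![_ * t]mulrC addrACA.
Qed.

Lemma principal_act x n u :
  principal (act x n u) = act x n (principal u) + (principal_degree x n)%:~R *: act x n u.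
Proof.
case: rep => _ comm _ _ dcomm.
have /eqP := dcomm x n u; rewrite subr_eq => /eqP dE.
have /eqP := comm sl_h x n 0 u; rewrite mul0r mulr0z scale0r if_same addr0 add0r.
rewrite subr_eq => /eqP hE.
rewrite /principal dE hE (linear_funD (lact _ _)) !(linear_funZ (lact _ _)).
rewrite !scalerDr addrACA addrC; congr (_ + _).
case: x {hE dE} => /=; rewrite ?scale0r ?scaler0 ?addr0 ?scalerA -?scalerDl;
  by congr (_ *: _); field.
Qed.

(** [M] is not assumed to be a sum of eigenspaces of [principal], so the part strictly below the
    weight of [v] is described by finite sums of eigenvectors. *)
Inductive lower : M -> Prop :=
| lower0 : lower 0
| lower_step k u t w : principal u = (b / 2 - k.+1%:R) *: u -> lower w ->
    lower (t *: u + w).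

Lemma lowerZ t u : lower u -> lower (t *: u).
Proof.
elim=> [|k {}u r w uE _ lw]; first by rewrite scaler0; left.
by rewrite scalerDr scalerA; apply: lower_step uE lw.
Qed.

Lemma lowerD u w : lower u -> lower w -> lower (u + w).
Proof.
move=> + lw; elim=> [|k {}u r z uE _ lz]; first by rewrite add0r.
by rewrite -addrA; apply: lower_step uE lz.
Qed.

Lemma lower_act x n u : (principal_degree x n < 0) -> lower u -> lower (act x n u).
Proof.
move=> xn0; elim=> [|k {}u t w uE _ lw]; first by rewrite (linear_fun0 (lact _ _)); left.
rewrite lact; apply: (lower_step (k := k + `|principal_degree x n|)) => //.
rewrite principal_act uE (linear_funZ (lact _ _)) -scalerDl; congr (_ *: _).
have {1}-> : principal_degree x n = - `|principal_degree x n|%N%:Z by lia.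
by rewrite mulrNz -addnS natrD -[_.+1%:R]natr1 -pmulrn; ring.
Qed.

(** The product of the operators [principal] - (b/2 - j) over 1 <= j <= n. For large n it kills a
    given element of [lower], whereas on the eigenvalue b/2 it is the scalar n!, which separates the
    two. *)
Fixpoint principal_prod (n : nat) (u : M) : M :=
  if n is n'.+1
  then principal (principal_prod n' u) - (b / 2 - n%:R) *: principal_prod n' u
  else u.

Lemma principal_prod_linear n : linear (principal_prod n).
Proof.
elim: n => // n IHn t x y /=; rewrite IHn principal_linear !scalerDr !scalerA scalerN.
by rewrite opprD addrACA ![_ * t]mulrC scalerA.
Qed.

Lemma principal_prod_eigen n t u : principal u = t *: u ->
  principal_prod n u = (\prod_(i < n) (t - b / 2 + i.+1%:R)) *: u.
Proof.
move=> uE; elim: n => [|n IHn] /=; first by rewrite big_ord0 scale1r.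
rewrite IHn big_ord_recr (linear_funZ principal_linear) uE !scalerA -scalerBl.
by congr (_ *: _) => /=; ring.
Qed.

Lemma lower_principal_prod u : lower u ->
  exists K, forall n, (K <= n)%N -> principal_prod n u = 0.
Proof.
elim=> [|k {}u t w uE _ [K KE]].
  by exists 0%N => n _; rewrite (linear_fun0 (principal_prod_linear n)).
exists (maxn K k.+1) => n; rewrite geq_max => /andP[Kn kn].
rewrite principal_prod_linear KE // addr0 (principal_prod_eigen _ uE).
rewrite (bigD1 (Ordinal kn)) //= [X in X * _](_ : _ = 0); last by ring.
by rewrite mul0r scale0r scaler0.
Qed.

Lemma lower_eigen u : principal u = (b / 2) *: u -> lower u -> u = 0.
Proof.
move=> uE /lower_principal_prod[K /(_ K (leqnn K))].
rewrite (principal_prod_eigen _ uE) => /eqP; rewrite scaler_eq0 => /orP[|/eqP//].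
rewrite prodf_seq_eq0 => /hasP[i _]; rewrite /= subrr add0r.
by rewrite pnatr_eq0.
Qed.

Lemma principal_hw : principal v = (b / 2) *: v.
Proof.
case: hw => _ _ hv _ dv.
by rewrite /principal dv hv scaler0 add0r scalerA mulrC.
Qed.

Definition negative_stable (P : set M) : Prop :=
  subspace P /\ forall x n u, principal_degree x n < 0 -> P u -> P (act x n u).

(** This stands in for the PBW equality U(g^).v = U(n_-).v. In the smallest n_- stable subspace [U]
    containing [v], the elements that every mode sends into [U] include [v] and are stable under n_-
    by the commutation relations; hence [U] is a submodule. *)
Lemma affine_span_negative_stable (P : set M) : negative_stable P -> P v ->
  affine_span act v `<=` P.
Proof.
move=> nsP Pv.
pose U := smallest negative_stable [set v].
have UP : U `<=` P by move=> u; apply; split => // _ ->.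
have Uv : U v by move=> Q [_]; apply.
have nsU : negative_stable U.
  split; first split.
  - by move=> Q [[[]]].
  - by move=> t x y Ux Uy Q sQ; case: (sQ) => -[[_ QL] _] _; exact: QL (Ux Q sQ) (Uy Q sQ).
  - by move=> x n u xn Uu Q sQ; case: (sQ) => -[_ Qact] _; exact: Qact xn (Uu Q sQ).
have [sU Uneg] := nsU.
suff UA : U `<=` [set u | U u /\ forall x n, U (act x n u)].
  apply: subset_trans UP; apply: affine_span_min Uv; split; [exact: sU.1|exact: sU.2|].
  by move=> x n u /UA[_]; apply.
move=> u; apply; split; last first.
  move=> _ ->; split=> // x n.
  (* The only mode of positive degree and index at most 0 is e(0), and the only one of degree 0 is
     h(0). *)
  have [xn|xn|xn] := ltrgtP (principal_degree x n) 0; first exact: Uneg.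
    case: hw => _ [ev pv] _ _ _.
    have [n0|n0] := ltrP 0 n; first by rewrite pv //; exact: sU.1.
    case: x xn => /= xn; [|lia|lia].
    by rewrite (_ : n = 0) ?ev; [exact: sU.1|lia].
  case: hw => _ _ hv _ _.
  case: x xn => /= xn; [lia|lia|].
  by rewrite (_ : n = 0) ?hv; [exact: (subspaceZ sU)|lia].
split; first split.
- by split=> [|x n]; rewrite ?(linear_fun0 (lact _ _)); exact: sU.1.
- move=> t x y [Ux Ax] [Uy Ay]; split; first exact: sU.2.
  by move=> z n; rewrite lact; apply: sU.2; [exact: Ax|exact: Ay].
- move=> x n y xn [Uy Ay]; split; first exact: Uneg.
  move=> z l; case: rep => _ /(_ z x n l y) /eqP + _ _ _.
  rewrite subr_eq => /eqP ->; apply: (subspaceD sU); last exact: Uneg.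
  apply: (subspaceD sU); first exact: (subspaceZ sU).
  by case: ifP => _; [do 2 apply: (subspaceZ sU)|exact: sU.1].
Qed.

(** The modes of n_- send both [v] and [lower] into [lower], so the line through [v] together with
    [lower] is stable under n_-. *)
Lemma affine_span_lower u : affine_span act v u -> exists t, lower (u - t *: v).
Proof.
apply: (affine_span_negative_stable (P := [set u | exists t, lower (u - t *: v)])).
  split; first split.
  - by exists 0; rewrite scale0r subrr; left.
  - move=> t x y [p lx] [q ly]; exists (t * p + q).
    rewrite scalerDl opprD addrACA -scalerA -scalerBr.
    by apply: lowerD => //; exact: lowerZ.
  - move=> x n y xn [p ly]; exists 0; rewrite scale0r subr0.
    have -> : act x n y = p *: act x n v + act x n (y - p *: v).
      by rewrite (linear_funB (lact _ _)) (linear_funZ (lact _ _)) addrC subrK.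
    (* [lower] records a gap of k + 1 below b/2, hence the predecessor. *)
    apply: (lower_step (k := `|principal_degree x n|.-1)); last exact: lower_act.
    rewrite principal_act principal_hw (linear_funZ (lact _ _)) -scalerDl.
    congr (_ *: _).
    have -> : `|principal_degree x n|.-1.+1 = `|principal_degree x n|%N by lia.
    have {1}-> : principal_degree x n = - `|principal_degree x n|%N%:Z by lia.
    by rewrite mulrNz -pmulrn.
by exists 1; rewrite scale1r subrr; left.
Qed.

End PrincipalGrading.

Section ProductRep.
Variables (F : fieldType) (M N : lmodType F).
Variables (actM : sl2_basis -> int -> M -> M) (actN : sl2_basis -> int -> N -> N).

Definition pair_map (f : M -> M) (g : N -> N) (u : M * N) : M * N :=
  (f u.1, g u.2).

Definition pair_act (x : sl2_basis) (n : int) := pair_map (actM x n) (actN x n).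

Lemma pair_map_linear f g : linear f -> linear g -> linear (pair_map f g).
Proof. by move=> lf lg t [u1 u2] [v1 v2]; rewrite /pair_map /= lf lg. Qed.

Lemma pair_affine_rep cM cN dM dN : affine_rep actM cM dM -> affine_rep actN cN dN ->
  affine_rep pair_act (pair_map cM cN) (pair_map dM dN).
Proof.
move=> [[lM [lcM ldM]] bM caM cdM daM] [[lN [lcN ldN]] bN caN cdN daN].
split=> [|x y m n [u w]|x n [u w]|[u w]|x n [u w]].
- by split=> [x n|]; last split; apply: pair_map_linear.
- have := bM x y m n u; have := bN x y m n w.
  rewrite /pair_act /pair_map; case: ifP => _ EN EM;
    by rewrite -[LHS]/(_ - _, _ - _) EN EM.
- by rewrite /pair_act /pair_map /= caM caN.
- by rewrite /pair_map /= cdM cdN.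
- by rewrite -[LHS]/(_ - _, _ - _) daM daN.
Qed.

Lemma pair_map_scale k : pair_map ( *:%R k) ( *:%R k) = *:%R k.
Proof. by apply/funext => -[]. Qed.

End ProductRep.

(** * An isomorphism as a graph in a direct sum *)

Section IrreducibleIso.
Variables (F : numFieldType) (M N : lmodType F) (a b : F).
Variables (actM : sl2_basis -> int -> M -> M) (dM : M -> M) (v : M).
Variables (actN : sl2_basis -> int -> N -> N) (dN : N -> N) (w : N).
Hypotheses (repM : affine_rep actM ( *:%R (a + b)) dM)
  (irrM : affine_irreducible actM ( *:%R (a + b)) dM)
  (hwM : highest_weight_vector a b actM ( *:%R (a + b)) dM v).
Hypotheses (repN : affine_rep actN ( *:%R (a + b)) dN)
  (hwN : highest_weight_vector a b actN ( *:%R (a + b)) dN w)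
  (simpleN : forall J, submodule actN J -> J `<=` affine_span actN w ->
     (exists2 x, J x & x != 0) -> J w).

Let act := pair_act actM actN.
Let d := pair_map dM dN.

Let rep : affine_rep act ( *:%R (a + b)) d.
Proof. by rewrite -pair_map_scale; exact: pair_affine_rep. Qed.

Let hw : highest_weight_vector a b act ( *:%R (a + b)) d (v, w).
Proof.
case: hwM hwN => vN0 [eM pM] hM _ dv0 [wN0 [eN pN] hN _ dw0].
split=> //; [|split=> [|x n n0]| |]; rewrite /act /pair_act /d /pair_map /=.
- by rewrite xpair_eqE (negPf vN0).
- by rewrite eM eN.
- by rewrite pM ?pN.
- by rewrite hM hN.
- by rewrite dv0 dw0.
Qed.

Let G : set (M * N) := affine_span act (v, w).

Let subG : submodule act G.
Proof. exact: affine_span_submodule. Qed.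

(* In the span of (v, w) the weight space of (v, w) is a line. *)
Let eigenG u : G u -> principal act d u = (b / 2) *: u -> exists t, u = t *: (v, w).
Proof.
move=> /(affine_span_lower rep hw)[t lu] uE; exists t.
apply/eqP; rewrite -subr_eq0; apply/eqP; refine (lower_eigen rep _ lu).
have lp := principal_linear rep.
rewrite (linear_funB lp) uE (linear_funZ lp) (principal_hw hw).
by rewrite scalerBr !scalerA [t * _]mulrC.
Qed.

Let principal_pair p q :
  principal act d (p, q) = (principal actM dM p, principal actN dN q).
Proof. by []. Qed.

(** The vector (v, 0) has the weight of (v, w), so in [G] it would be a multiple t (v, w); then t w
    = 0 gives t = 0 and v = 0. *)
Let fstG : ~ G (v, 0).
Proof.
case: (hwN) => /negP wN0 _ _ _ _ /eigenG[|t [vE /esym/eqP]].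
  rewrite principal_pair (principal_hw hwM) (linear_fun0 (principal_linear repN)).
  by rewrite -[RHS]/(_ *: v, _ *: 0) scaler0.
rewrite scaler_eq0 => /orP[/eqP t0|//].
case: (hwM) => /eqP + _ _ _ _; apply.
by rewrite vE t0 scale0r.
Qed.

Let sndG : ~ G (0, w).
Proof.
case: (hwM) => /negP vN0 _ _ _ _ /eigenG[|t [/esym/eqP + wE]].
  rewrite principal_pair (principal_hw hwN) (linear_fun0 (principal_linear repM)).
  by rewrite -[RHS]/(_ *: 0, _ *: w) scaler0.
rewrite scaler_eq0 => /orP[/eqP t0|//].
case: (hwN) => /eqP + _ _ _ _; apply.
by rewrite wE t0 scale0r.
Qed.

Let lactM x n : linear (actM x n).
Proof. by case: repM => -[]. Qed.

Let lactN x n : linear (actN x n).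
Proof. by case: repN => -[]. Qed.

Let ldN : linear dN.
Proof. by case: repN => -[_ []]. Qed.

Let spanG u : G u -> affine_span actN w u.2.
Proof.
have subS := affine_span_submodule actN w.
apply: (affine_span_min (P := [set u | affine_span actN w u.2])).
  case: subS => S0 SL Sact; split => //= [t x y|x n y]; first exact: SL.
  exact: Sact.
exact: affine_span_gen.
Qed.

(** The p with (p, 0) in [G] form a submodule of the irreducible [M], and [fstG] excludes that it is
    all of [M]. *)
Let kerM p : G (p, 0) -> p = 0.
Proof.
case: (subG) => _ GL Gact Gp.
have [||t|P0|PT] := irrM (P := [set p | G (p, 0)]).
- split=> [|t x y Gx Gy|x n y Gy] /=; first by case: subG.
    by have := GL t _ _ Gx Gy; rewrite -[X in G X]/(_, _ *: 0 + 0) scaler0 addr0.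
  by have := Gact x n _ Gy; rewrite /act /pair_act /pair_map /= (linear_fun0 (lactN _ _)).
- move=> t /= Gt; have := subspaceZ (submodule_subspace subG) (a + b) Gt.
  by rewrite -[X in G X]/(_, _ *: 0) scaler0.
- move=> Gt; case: hw => _ _ _ _ dv0; have := affine_span_d rep dv0 Gt.
  by rewrite /d /pair_map /= (linear_fun0 ldN).
- by have : [set p | G (p, 0)] p by []; rewrite P0.
- by case: fstG; have : [set p | G (p, 0)] v by rewrite PT.
Qed.

(** The q with (0, q) in [G] form a submodule of the span of [w]; if it were nonzero, [simpleN]
    would put [w] in it, against [sndG]. *)
Let kerN q : G (0, q) -> q = 0.
Proof.
case: (subG) => _ GL Gact Gq; apply/eqP/negPn/negP => qN0; apply: sndG.
apply: (simpleN (J := [set q | G (0, q)])); last by exists q.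
  split=> [|t x y Gx Gy|x n y Gy] /=; first by case: subG.
    by have := GL t _ _ Gx Gy; rewrite -[X in G X]/(_ *: 0 + 0, _) scaler0 addr0.
  by have := Gact x n _ Gy; rewrite /act /pair_act /pair_map /= (linear_fun0 (lactM _ _)).
by move=> x /spanG.
Qed.

Let totalM p : exists q, G (p, q).
Proof.
have : affine_span actM v p by rewrite (irreducible_hw_span repM irrM hwM).
apply: (affine_span_min (P := [set p | exists q, G (p, q)])); last first.
  by exists w; exact: affine_span_gen.
case: (subG) => G0 GL Gact; split=> [|t x y [q Gq] [r Gr]|x n y [q Gq]].
- by exists 0.
- by exists (t *: q + r); exact: GL t _ _ Gq Gr.
- by exists (actN x n q); exact: Gact x n _ Gq.
Qed.

Let phi p : N := sval (cid (totalM p)).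

Let phiP p : G (p, phi p).
Proof. by rewrite /phi; case: cid. Qed.

Let phi_uniq p q : G (p, q) -> phi p = q.
Proof.
move=> Gq; apply/eqP; rewrite -subr_eq0; apply/eqP/kerN.
by have := subspaceB (submodule_subspace subG) (phiP p) Gq;
  rewrite -[X in G X]/(p - p, _) subrr.
Qed.

Let phi_linear : linear phi.
Proof.
by case: (subG) => _ GL _ t x y; apply: phi_uniq; exact: GL t _ _ (phiP x) (phiP y).
Qed.

(* The span of (v, w) in the direct sum is the graph of the isomorphism. *)
Lemma irreducible_hw_iso : exists phi : {linear M -> N},
  [/\ injective phi, range phi = affine_span actN w
    & forall x n u, phi (actM x n u) = actN x n (phi u)].
Proof.
pose L := GRing.isLinear.Build _ _ _ _ phi phi_linear.
exists (HB.pack_for {linear M -> N} phi L); split=> /=.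
- move=> x y xy; apply/eqP; rewrite -subr_eq0; apply/eqP/kerM.
  by have := subspaceB (submodule_subspace subG) (phiP x) (phiP y);
    rewrite xy -[X in G X]/(_, _ - _) subrr.
- apply/seteqP; split=> [_ [p _ <-]|]; first exact: spanG (phiP p).
  have [_ GL Gact] := subG.
  apply: affine_span_min; last first.
    by exists v => //; apply: phi_uniq; exact: affine_span_gen.
  split=> [|t _ _ [x _ <-] [y _ <-]|x n _ [y _ <-]].
  + by exists 0 => //; exact: linear_fun0.
  + by exists (t *: x + y) => //; exact: phi_linear.
  + by exists (actM x n y) => //; apply: phi_uniq; exact: Gact x n _ (phiP y).
- by move=> x n u; case: (subG) => _ _ Gact; apply: phi_uniq; exact: Gact x n _ (phiP u).
Qed.

End IrreducibleIso.

(** * Weak modules and the twisting functor *)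

(** A weak module carries no operator d; this is what remains of [affine_rep] when c is the scalar
    k. *)
Definition affine_comm (F : fieldType) (M : lmodType F) (k : F)
    (act : sl2_basis -> int -> M -> M) : Prop :=
  (forall x n, linear (act x n)) /\ forall x y m n v,
    act x n (act y m v) - act y m (act x n v)
    = (sl2_bracket x y).1%:~R *: act (sl2_bracket x y).2 (n + m) v
      + (if n + m == 0 then (n * sl2_form x y)%:~R *: (k *: v) else 0).

Lemma affine_comm_rep (F : fieldType) (M : lmodType F) (k : F) act (d : M -> M) :
    affine_comm k act -> linear d ->
    (forall x n v, d (act x n v) - act x n (d v) = n%:~R *: act x n v) ->
  affine_rep act ( *:%R k) d.
Proof.
move=> [lact comm] ld dact; split=> // [|x n v|v].
- split=> //; split=> // t u v.
  by rewrite scalerDr !scalerA mulrC.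
- by rewrite (linear_funZ (lact _ _)).
- by rewrite (linear_funZ ld).
Qed.

Section Twist.
Variables (F : fieldType) (M : lmodType F) (k : F) (s : int).
Variables (act : sl2_basis -> int -> M -> M).

Definition twist_shift (x : sl2_basis) : int :=
  match x with sl_e => - s | sl_f => s | sl_h => 0 end.

Definition twist_const (x : sl2_basis) (n : int) : F :=
  if x is sl_h then if n == 0 then - (s%:~R * k) else 0 else 0.

(* The action on pi_s(M), at level k. *)
Definition twist_act (x : sl2_basis) (n : int) (v : M) : M :=
  act x (n + twist_shift x) v + twist_const x n *: v.

(** The index shifts add up along brackets. For e and f they cancel, and the central term changes
    from n k to (n - s) k, which the constant -s k of h(0) absorbs. *)
Lemma twist_act_comm : affine_comm k act -> affine_comm k twist_act.
Proof.
move=> [lact comm]; split=> [x n t u v|x y m n v]; rewrite /twist_act.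
  by rewrite lact !scalerDr !scalerA [_ * t]mulrC addrACA.
rewrite !(linear_funD (lact _ _)) !(linear_funZ (lact _ _)) !scalerDr !scalerA.
rewrite [twist_const y m * _]mulrC.
set A := act x _ (act y _ v); set B := act y _ (act x _ v).
set p := twist_const x n *: _; set q := twist_const y m *: _.
set r := (twist_const x n * _) *: v.
have -> : A + q + (p + r) - (B + p + (q + r)) = A - B.
  by rewrite (addrACA B p q r) opprD addrACA subrr addr0 opprD addrACA subrr addr0.
rewrite /A /B comm scalerA {A B p q r}.
have -> : n + twist_shift x + (m + twist_shift y)
    = n + m + (twist_shift x + twist_shift y) by rewrite addrACA.
case: x; case: y => /=; do ?rewrite (addNr, addrN, mul0r, mulr0, mulr0z, mulr1,
  scale0r, if_same, addr0, add0r) //; case: ifP => _; rewrite ?(mulr0, scale0r, addr0) //;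
  by rewrite -addrA -scalerDl; congr (_ + _ *: _); rewrite ?intrB ?intrD; ring.
Qed.

End Twist.

Lemma binzn0 (F : numFieldType) (m : int) : binz F m 0 = 1.
Proof. by rewrite /binz big_ord0 divr1. Qed.

Lemma binzn1 (F : numFieldType) (m : int) : binz F m 1 = m%:~R.
Proof. by rewrite /binz big_ord1 subr0 divr1. Qed.

Lemma binz0n (F : numFieldType) (i : nat) : binz F 0 i.+1 = 0.
Proof. by rewrite /binz big_ord_recl subrr !mul0r. Qed.

(** * Coefficients of exponentials *)

Section ExpCoef.
Variables (F : numFieldType) (V : lmodType F) (x : nat -> V -> V).

Lemma pow_coef0 k m :
  (forall n, x n 0 = 0) -> pow_coef x k m 0 = 0.
Proof.
move=> x0; elim: k m => [|k IHk] m /=; first by rewrite if_same.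
by rewrite big1 // => i _; rewrite IHk x0.
Qed.

Lemma exp_coef0 v : exp_coef x 0 v = v.
Proof. by rewrite /exp_coef big_ord1 /= invr1 scale1r. Qed.

Lemma exp_coef2 v : (forall n, x n 0 = 0) ->
  exp_coef x 2 v = x 2 v + 2^-1 *: x 1 (x 1 v).
Proof.
move=> x0; rewrite /exp_coef !big_ord_recl big_ord0 /= scaler0 addr0 add0r.
rewrite (_ : 1`!%:R^-1 = 1 :> F) ?invr1 // scale1r.
rewrite big_mkcond !big_ord_recl big_ord0 /= x0 add0r addr0 add0r.
rewrite big_mkcond !big_ord_recl big_ord0 /= add0r addr0.
rewrite big_mkcond !big_ord_recl big_ord0 /= add0r addr0.
rewrite big_mkcond !big_ord_recl big_ord0 /=.
by rewrite addr0 x0 addr0.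
Qed.

Lemma exp_coef_linear j : (forall n, linear (x n)) -> linear (exp_coef x j).
Proof.
move=> lx.
have lp k m : linear (pow_coef x k m).
  elim: k m => [|k IHk] m t u v /=; first by case: eqP => // _; rewrite scaler0 addr0.
  rewrite scaler_sumr -big_split; apply: eq_bigr => i _ /=.
  by rewrite IHk lx.
move=> t u v; rewrite /exp_coef scaler_sumr -big_split; apply: eq_bigr => i _ /=.
by rewrite lp scalerDr !scalerA mulrC.
Qed.

(** In a product of at least two factors of total degree j, the factor applied first has an index
    strictly between 0 and j, hence kills [v]; only the linear term of the exponential is left. *)
Lemma exp_coef_lead j v : (forall n, x n 0 = 0) -> (0 < j)%N ->
  (forall i, (0 < i < j)%N -> x i v = 0) -> exp_coef x j v = x j v.
Proof.
move=> x0 j0 xv.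
have p1 m : pow_coef x 1 m v = if m == 0%N then 0 else x m v.
  case: m => [|m] /=; first by rewrite big_ord1_cond.
  rewrite big_mkcond big_ord_recr /= subnn big1 ?add0r // => i _.
  by rewrite subn_eq0 (leqNgt m.+1) /= ltn_ord x0 if_same.
have p2 k m : (m <= j)%N -> pow_coef x k.+2 m v = 0.
  have pS k' m' : pow_coef x k'.+1 m' v =
    \sum_(i < m'.+1 | (0 < i)%N) x i (pow_coef x k' (m' - i)%N v) by [].
  elim: k m => [|k IHk] m mj; rewrite pS big1 // => i i0.
    rewrite p1; case: eqP => [_|/eqP mi]; first exact: x0.
    by rewrite (xv (m - i)%N) ?x0 // lt0n mi /=; lia.
  by rewrite IHk ?x0 //; lia.
case: j j0 xv p2 => // j _ xv p2.
rewrite /exp_coef 2!big_ord_recl p1 -[pow_coef _ _ _ _]/(0 : V) scaler0 add0r.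
rewrite -[X in X^-1 *: _](_ : 1 = _) // invr1 scale1r big1 ?addr0 // => i _.
by rewrite -[pow_coef _ _ _ _]/(pow_coef x i.+2 j.+1 v) p2 // scaler0.
Qed.

End ExpCoef.

Section ExpCoefTruncated.
Variables (F : numFieldType) (M : lmodType F) (x : nat -> M -> M) (a z : M).
Hypotheses (x0 : forall n, x n 0 = 0) (xz : forall n, (0 < n)%N -> x n z = 0)
  (xa : forall n, (0 < n)%N -> x n a = if n == 1%N then z else 0).

(** The only nonzero first step sends [a] to [z], on which every further factor vanishes, so the
    exponential stops after its linear term. *)
Lemma pow_coef_truncated k m : pow_coef x k m a =
  if (k == 0%N) && (m == 0%N) then a else if (k == 1%N) && (m == 1%N) then z else 0.
Proof.
elim: k m => [|k IHk] m /=; first by case: eqP.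
case: k IHk => [|k] IHk /=.
  case: m => [|m]; first by rewrite big_ord1_cond.
  rewrite big_mkcond big_ord_recr /= subnn xa // big1 ?add0r // => i _.
  by rewrite subn_eq0 (leqNgt m.+1) /= ltn_ord x0 if_same.
rewrite big1 // => i i0; rewrite -[X in x _ X]/(pow_coef x k.+1 _ a) IHk /=.
by case: ifP => _; [exact: xz|exact: x0].
Qed.

Lemma exp_coef_truncated m : exp_coef x m a =
  if m == 0%N then a else if m == 1%N then z else 0.
Proof.
rewrite /exp_coef; under eq_bigr do rewrite pow_coef_truncated.
case: m => [|[|m]]; first by rewrite big_ord1 /= invr1 scale1r.
  by rewrite !big_ord_recl big_ord0 /= scaler0 add0r addr0 invr1 scale1r.
rewrite big1 // => i _; rewrite !andbF; exact: scaler0.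
Qed.

End ExpCoefTruncated.

(** * Weak modules over L(k Lambda_0) *)

Section VertexAlgebraModules.
Variables (F : numFieldType) (V : vertex_algebra F).

Let vac := va_vac V.

Lemma va_prod_vac (a : V) (n : int) :
  0 <= n -> va_prod a n vac = 0.
Proof. by move=> n0; have [_ ->] := va_creation a. Qed.

Lemma va_prod_creation (a : V) : va_prod a (-1) vac = a.
Proof. by have [] := va_creation a. Qed.

Section Module.
Variables (M : lmodType F) (Y : V -> int -> M -> M).
Hypothesis modY : weak_module V Y.

Lemma weak_module_lin (a : V) n : linear (Y a n).
Proof. by case: modY => _ + _ _ _; apply. Qed.

Lemma weak_module_linl n x : linear (fun a => Y a n x).
Proof. by case: modY. Qed.

Lemma weak_module0 n x : Y 0 n x = 0.
Proof. exact: (linear_fun0 (weak_module_linl n x)). Qed.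

Lemma weak_module_vac n x : Y vac n x = if n == -1 then x else 0.
Proof. by case: modY => _ _ _ + _; apply. Qed.

(* The Jacobi identity with l = 0. *)
Lemma weak_module_comm (a b : V) (m n : int) x :
    (forall i : nat, (1 < i)%N -> va_prod a i%:Z b = 0) ->
  Y a m (Y b n x) - Y b n (Y a m x)
  = Y (va_prod a 0 b) (m + n) x + m%:~R *: Y (va_prod a 1 b) (m + n - 1) x.
Proof.
move=> ab0; case: modY => _ _ _ _ /(_ a b x 0 m n).
rewrite (fsbigE [:: 0%N; 1%N]) //; last first.
  by move=> [|[|i]] // _ _; rewrite add0r ab0 // weak_module0 scaler0.
rewrite (fsbigE [:: 0%N]) //; last first.
  by move=> [|i] // _ _; rewrite binz0n mulr0 scale0r.
rewrite !big_cons !big_nil !in_setT /= !binzn0 binzn1 !addr0 expr0z !scale1r mul1r.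
by rewrite scale1r => <-; rewrite add0r.
Qed.

(* The Jacobi identity with m = 0. *)
Lemma weak_module_prod (a b : V) (l n : int) x :
  Y (va_prod a l b) n x = \sum_(i \in [set: nat]) ((-1) ^+ i * binz F l i) *:
    (Y a (l - i%:Z) (Y b (n + i%:Z) x)
     - (-1) ^ l *: Y b (n + l - i%:Z) (Y a i%:Z x)).
Proof.
case: modY => _ _ _ _ /(_ a b x l 0 n).
rewrite (fsbigE [:: 0%N]) //; last first.
  by move=> [|i] // _ _; rewrite binz0n scale0r.
rewrite big_cons big_nil in_setT /= binzn0 scale1r => E.
transitivity (Y (va_prod a (l + 0%Z) b) (0 + n - 0%Z) x + 0).
  by rewrite addr0; congr (Y (va_prod a _ b) _ x); lia.
by rewrite E; apply: eq_fsbigr => i _; rewrite !add0r.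
Qed.

End Module.

Variables (k : F) (g : sl2_basis -> V).
Hypothesis hV : is_affine_VOA k g.

Let hV_rep : exists c d, [/\ affine_rep (modes g (@va_prod F V)) c d,
  affine_irreducible (modes g (@va_prod F V)) c d,
  highest_weight_vector k 0 (modes g (@va_prod F V)) c d vac &
  forall u, c u = k *: u].
Proof.
have [c [d [rep irr hw]]] := hV; exists c, d; split=> // u.
by rewrite (irreducible_hw_c rep irr hw) addr0.
Qed.

Lemma affine_VOA_span : affine_span (modes g (@va_prod F V)) vac = [set: V].
Proof. by have [c [d [rep irr hw]]] := hV; rewrite (irreducible_hw_span rep irr hw). Qed.

(** Write [g y] as y(-1) applied to the vacuum and move x(n) to the right, where it kills the
    vacuum. *)
Lemma affine_VOA_prod x y (n : nat) : va_prod (g x) n%:Z (g y) =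
  (if n == 0%N then (sl2_bracket x y).1%:~R *: g (sl2_bracket x y).2 else 0)
  + (if n == 1%N then ((sl2_form x y)%:~R * k) *: vac else 0).
Proof.
have [c [d [[_ comm _ _ _] _ _ cE]]] := hV_rep.
have := comm x y (-1) n%:Z vac; rewrite /modes va_prod_creation (va_prod_vac (g x)) //.
rewrite (linear_fun0 (weak_module_lin (va_module V) _ _)) subr0 => ->.
rewrite cE scalerA; case: n => [|[|n]].
- by rewrite add0r va_prod_creation.
- by rewrite !subrr /= va_prod_vac // scaler0 mul1r.
- have -> : n.+2%:Z - 1 = n.+1%:Z by lia.
  by rewrite va_prod_vac // scaler0.
Qed.

Section Module2.
Variables (M : lmodType F) (Y : V -> int -> M -> M).
Hypothesis modY : weak_module V Y.

Lemma weak_module_affine_comm : affine_comm k (modes g Y).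
Proof.
split=> [x n|x y m n u]; rewrite /modes; first exact: weak_module_lin.
rewrite (weak_module_comm modY) => [|i i1]; last first.
  by rewrite affine_VOA_prod; case: i i1 => [|[]] // *; rewrite addr0.
have ZY c a l : Y (c *: a) l u = c *: Y a l u.
  exact: (linear_funZ (weak_module_linl modY l u)).
rewrite (affine_VOA_prod x y 0) (affine_VOA_prod x y 1) /=.
rewrite addr0 add0r !ZY (weak_module_vac modY); congr (_ + _).
(* The vacuum mode has index n + m - 1, so it is the identity exactly when n + m = 0. *)
rewrite -[_ == -1](_ : (n + m == 0) = _); last by apply/eqP/eqP; lia.
by case: ifP => _; rewrite ?scaler0 // !scalerA intrM mulrA.
Qed.

End Module2.

Section Generation.
Variables (M N : lmodType F) (YM : V -> int -> M -> M) (YN : V -> int -> N -> N).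
Hypotheses (modM : weak_module V YM) (modN : weak_module V YN).
Variable phi : {linear M -> N}.
Hypothesis inj_phi : injective phi.

(** The vectors whose modes [phi] intertwines form a submodule of [V] containing the vacuum, since
    the Jacobi identity expresses the modes of x(l) b through those of x and b. Injectivity of [phi]
    keeps the supports of these infinite sums unchanged. *)
Lemma intertwine_modes :
  (forall x n u, phi (YM (g x) n u) = YN (g x) n (phi u)) ->
  forall a n u, phi (YM a n u) = YN a n (phi u).
Proof.
move=> Hg a; have : affine_span (modes g (@va_prod F V)) vac a by rewrite affine_VOA_span.
apply: (affine_span_min (P := [set a | forall n u, phi (YM a n u) = YN a n (phi u)])).
  split=> [n u|t b c Hb Hc n u|x l b Hb n u] /=.
  - by rewrite !weak_module0 // linear0.
  - by rewrite (weak_module_linl modM) (weak_module_linl modN) linearP Hb Hc.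
  - rewrite /modes !weak_module_prod // linear_fsum //; apply: eq_fsbigr => i _.
    by rewrite linearZ linearB linearZ /= !Hg !Hb Hg.
by move=> n u; rewrite !weak_module_vac //; case: ifP => // _; exact: linear0.
Qed.

End Generation.

Section Pi.
Variables (s : int) (M : lmodType F) (Y Ys : V -> int -> M -> M).
Hypotheses (modY : weak_module V Y) (piY : is_pi g s Y Ys).

Let prod_twistH n b : va_prod (twistH g s) n b = - (s%:~R / 2) *: va_prod (g sl_h) n b.
Proof. exact: (linear_funZ (weak_module_linl (va_module V) n b)). Qed.

(** For n >= 1, H^s(n) can be nonzero on [g x] only if n = 1 and x = h, where it gives -s k times
    the vacuum. *)
Lemma Delta_coef_gen x m : Delta_coef g s m (g x) =
  if m == 0%N then g x else if m == 1%N then twist_const k s x 0 *: vac else 0.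
Proof.
apply: exp_coef_truncated => [n|n n0|n n0].
- rewrite (linear_fun0 (weak_module_lin (va_module V) _ _)); exact: scaler0.
- rewrite (linear_funZ (weak_module_lin (va_module V) _ _)) va_prod_vac //.
  by rewrite !scaler0.
- rewrite prod_twistH affine_VOA_prod; case: n n0 => [|[|n]] //= _; last first.
    by rewrite addr0 !scaler0.
  rewrite add0r !scalerA; congr (_ *: _).
  case: x => /=; rewrite ?mul0r ?mulr0 //.
  by field.
Qed.

Lemma pi_modes x n u : Ys (g x) n u = twist_act k s (modes g Y) x n u.
Proof.
(* The eigenvalues of H^s(0) on e, f, h are -s, s, 0, the values of [twist_shift]. *)
case: piY => _ /(_ (g x) (twist_shift s x)) ->; last first.
  rewrite prod_twistH (affine_VOA_prod sl_h x 0) addr0 scalerA.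
  case: x => /=; last by rewrite mulr0 !scale0r.
    by rewrite mulrNz; congr (_ *: _); field.
  by congr (_ *: _); field.
rewrite (fsbigE [:: 0%N; 1%N]) //; last first.
  by move=> [|[|i]] // _ _; rewrite Delta_coef_gen weak_module0.
rewrite !big_cons !big_nil !in_setT !Delta_coef_gen /= addr0 /twist_act /modes.
have ZY c a l : Y (c *: a) l u = c *: Y a l u.
  exact: (linear_funZ (weak_module_linl modY l u)).
rewrite addr0 ZY (weak_module_vac modY); congr (_ + _).
case: x; rewrite ?scale0r //= addr0.
have -> : (n - 1%N%:Z == -1) = (n == 0) by lia.
by case: ifP => _; rewrite ?scaler0 ?scale0r.
Qed.

End Pi.

(* Twisting the target by [s] turns an intertwiner into one from pi_(-s). *)
Lemma pi_iso a b (M N : lmodType F) (YM Ms : V -> int -> M -> M)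
    (YN : V -> int -> N -> N) (s : int) (v : M) (w : N) (d : N -> N) :
    weak_module V YM -> weak_module V YN -> is_pi g (- s) YM Ms ->
    a + b = k -> is_irreducible_hw a b (modes g YM) v ->
    linear d ->
    (forall x n u, d (twist_act k s (modes g YN) x n u)
       - twist_act k s (modes g YN) x n (d u)
       = n%:~R *: twist_act k s (modes g YN) x n u) ->
    highest_weight_vector a b (twist_act k s (modes g YN)) ( *:%R k) d w ->
    (forall J, submodule (twist_act k s (modes g YN)) J ->
       J `<=` affine_span (twist_act k s (modes g YN)) w ->
       (exists2 x, J x & x != 0) -> J w) ->
  weak_iso_onto Ms YN (affine_span (modes g YN) w).
Proof.
move=> modM modN piM abk [cM [dM [repM irrM hwM]]] ld dact hwN simpleN.
have cE u : cM u = (a + b) *: u := irreducible_hw_c repM irrM hwM u.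
have {cE} cE : cM = *:%R k by apply/funext => u; rewrite cE abk.
have [lYN commN] := twist_act_comm s (weak_module_affine_comm modN).
have repN := affine_comm_rep (conj lYN commN) ld dact.
(* A twisted mode is a shifted mode plus a scalar and conversely, so both actions have the same
   submodules. *)
have spanE : affine_span (twist_act k s (modes g YN)) w = affine_span (modes g YN) w.
  have [lY0 _] := weak_module_affine_comm modN.
  apply/seteqP; split; apply: affine_span_min; do ?exact: affine_span_gen.
    have subS := affine_span_submodule (modes g YN) w.
    have [S0 SL Sact] := subS; split=> // x n u Su.
    apply: (subspaceD (submodule_subspace subS)); first exact: Sact.
    exact: (subspaceZ (submodule_subspace subS)).
  set S := affine_span _ w.
  have subS : submodule _ S := affine_span_submodule (twist_act k s (modes g YN)) w.
  have [S0 SL Sact] := subS; split=> // x n u Su.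
  have -> : modes g YN x n u = twist_act k s (modes g YN) x (n - twist_shift s x) u
      - twist_const k s x (n - twist_shift s x) *: u.
    by rewrite /twist_act addrK subrK.
  apply: (subspaceB (submodule_subspace subS)); first exact: Sact.
  exact: (subspaceZ (submodule_subspace subS)).
rewrite {}cE in repM irrM hwM.
have [||||||phi [inj_phi rangephi Hphi]] :=
  irreducible_hw_iso (a := a) (b := b) (v := v) (w := w) (dM := dM) (dN := d)
    (actM := modes g YM) (actN := twist_act k s (modes g YN)); rewrite ?abk //.
exists phi; split=> //; first by rewrite rangephi.
case: (piM) => modMs _; apply: intertwine_modes => // x n u.
(* The twist by -s on the source and the twist by s on the target cancel, in the indices and in the
   constants. *)
rewrite (pi_modes modM piM) linearD linearZ /= Hphi /twist_act -addrA -scalerDl.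
rewrite (_ : _ + _ = 0 :> F) ?scale0r ?addr0; last first.
  by case: x => /=; rewrite ?addr0 //; case: ifP => _; rewrite ?addr0 //;
    rewrite mulrNz mulNr opprK addNr.
by congr (YN _ _ _); case: x => /=; lia.
Qed.

End VertexAlgebraModules.

(** * The grading of V_L *)

Section LinExt.
Variable F : numFieldType.
Implicit Types (E : fock_index -> VL F) (v : VL F).

Lemma lin_extEw E v (D : {fset fock_index}) : (msupp v `<=` D)%fset ->
  lin_ext E v = \sum_(i <- D) v@_i *: E i.
Proof.
move=> sD; rewrite /lin_ext; apply: big_fset_incl => // i _.
by rewrite -mcoeff_eq0 => /eqP ->; rewrite scale0r.
Qed.

Lemma lin_ext_linear E : linear (lin_ext E).
Proof.
move=> t u v; pose D := (msupp u `|` msupp v)%fset.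
have uD : (msupp u `<=` D)%fset by apply: fsubsetUl.
have vD : (msupp v `<=` D)%fset by apply: fsubsetUr.
rewrite (lin_extEw E uD) (lin_extEw E vD) (lin_extEw E (D := D)); last first.
  apply: fsubset_trans (msuppD_le _ _) _; rewrite fsubUset vD andbT.
  exact: fsubset_trans (msuppZ_le _ _) uD.
rewrite scaler_sumr -big_split; apply: eq_bigr => i _ /=.
by rewrite mcoeffD mcoeffZ scalerDl scalerA.
Qed.

Lemma lin_ext_fock E u be : lin_ext E (fock_vec F u be) = E (u, be).
Proof.
by rewrite /lin_ext /fock_vec msuppU oner_eq0 big_seq_fset1 mcoeffUU scale1r.
Qed.

Lemma fock_expansion v :
  v = \sum_(i <- msupp v) v@_i *: fock_vec F i.1 i.2.
Proof.
rewrite {1}[v]monalgE; apply: eq_bigr => -[u be] _; apply/malgP => j.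
by rewrite mcoeffZ !mcoeffU mulr_natr.
Qed.

Lemma fock_ind (P : set (VL F)) (v : VL F) : subspace P ->
  (forall i, i \in msupp v -> P (fock_vec F i.1 i.2)) -> P v.
Proof.
move=> sP Pi; rewrite [v]fock_expansion; apply: (subspace_sum sP) => i iv _.
by apply: (subspaceZ sP); exact: Pi.
Qed.

End LinExt.

(** An entry (b, n) encodes the creation operator b(-n-1), of weight n + 1. *)
Definition mset_weight (u : {mset (bool * nat)%type}%mset) : nat :=
  \sum_(x <- u) x.2.+1.

Lemma mset_weight0 : mset_weight mset0%mset = 0%N.
Proof. by rewrite /mset_weight enum_mset0 big_nil. Qed.

Lemma mset_weightD1 x u : mset_weight (x +` u)%mset = (x.2.+1 + mset_weight u)%N.
Proof.
rewrite /mset_weight -[u in LHS]seq_mset_id -mset_cons.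
by rewrite (perm_big _ (perm_eq_seq_mset _)) big_cons.
Qed.

Lemma mset_weightB1 x u : x \in u ->
  mset_weight u = (x.2.+1 + mset_weight (u `\ x)%mset)%N.
Proof. by move=> /msetB1K {1}<-; rewrite mset_weightD1. Qed.

Section Grading.
Variable F : numFieldType.
Implicit Types (d n : int) (be : lat) (v : VL F).

(** The degree is an integer so that a mode lowering it below 0 is seen to vanish, by
    [graded_neg]. *)
Definition graded d be : set (VL F) :=
  [set v | forall i, i \in msupp v -> (mset_weight i.1)%:Z = d /\ i.2 = be].

Lemma graded_subspace d be : subspace (graded d be).
Proof.
split=> [i|t u v Gu Gv i]; first by rewrite msupp0 inE.
move=> /(fsubsetP (msuppD_le _ _)); rewrite inE => /orP[]; last exact: Gv.
by move=> /(fsubsetP (msuppZ_le _ _)); exact: Gu.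
Qed.

Lemma graded_fock u be : graded (mset_weight u) be (fock_vec F u be).
Proof. by move=> i; rewrite msuppU oner_eq0 inE => /eqP ->. Qed.

Lemma graded_neg d be v : d < 0 -> graded d be v -> v = 0.
Proof.
move=> d0 Gv; apply/malgP => i; rewrite mcoeff0; apply/eqP.
by rewrite mcoeff_eq0; apply/negP => /Gv[]; lia.
Qed.

Lemma graded_lin_ext E d be v (P : set (VL F)) : subspace P -> graded d be v ->
  (forall u, (mset_weight u)%:Z = d -> P (E (u, be))) -> P (lin_ext E v).
Proof.
move=> sP Gv PE; apply: (subspace_sum sP) => -[u be'] /Gv[/= du ->] _.
by apply: (subspaceZ sP); exact: PE.
Qed.

Lemma heis_graded b n d be v : graded d be v -> graded (d - n) be (heis b n v).
Proof.
move=> Gv; apply: graded_lin_ext Gv _; first exact: graded_subspace.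
move=> u du; case: n => [[|n]|n] /=.
- rewrite subr0 -du; apply: (subspaceZ (graded_subspace _ _)).
  exact: graded_fock.
- have [bu|] := boolP ((b, n) \in u); last first.
    by move=> /mset_eq0P ->; rewrite mulr0 scale0r; exact: (graded_subspace _ _).1.
  apply: (subspaceZ (graded_subspace _ _)).
  rewrite (_ : d - _ = mset_weight (u `\ (b, n))%mset); first exact: graded_fock.
  by move: (mset_weightB1 bu) => /=; lia.
- rewrite (_ : d - _ = mset_weight ((b, n) +` u)%mset); first exact: graded_fock.
  by rewrite mset_weightD1 /=; lia.
Qed.

Lemma lat_heis_graded al n d be v : graded d be v -> graded (d - n) be (lat_heis al n v).
Proof.
move=> Gv; apply: (subspace_sum (graded_subspace _ _)) => b _ _.
by apply: (subspaceZ (graded_subspace _ _)); exact: heis_graded.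
Qed.

Lemma exp_coef_graded (x : nat -> VL F -> VL F) (eps : int) be :
  (forall (n : nat) d v, graded d be v -> graded (d + eps * n%:Z) be (x n v)) ->
  forall (n : nat) d v, graded d be v -> graded (d + eps * n%:Z) be (exp_coef x n v).
Proof.
move=> Gx n d v Gv; apply: (subspace_sum (graded_subspace _ _)) => k _ _.
apply: (subspaceZ (graded_subspace _ _)).
move: (nat_of_ord k) => {}k; elim: k n => [|k IHk] n /=.
  case: eqP => [->|_]; last exact: (graded_subspace _ _).1.
  by rewrite mulr0 addr0.
apply: (subspace_sum (graded_subspace _ _)) => i _ _.
rewrite (_ : d + _ = d + eps * (n - i)%N%:Z + eps * i%:Z); first exact: Gx.
by have := ltn_ord i; rewrite ltnS => /subnK {1}<-; rewrite PoszD; ring.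
Qed.

Lemma exp_minus_graded al i d be v :
  graded d be v -> graded (d + i%:Z) be (exp_minus al i v).
Proof.
move=> Gv; rewrite -[i%:Z]mul1r; apply: exp_coef_graded Gv => n {}d {}v Gv.
apply: (subspaceZ (graded_subspace _ _)).
rewrite (_ : d + _ = d - - n%:Z); last by rewrite mul1r opprK.
exact: lat_heis_graded.
Qed.

Lemma exp_plus_graded al j d be v :
  graded d be v -> graded (d - j%:Z) be (exp_plus al j v).
Proof.
move=> Gv; rewrite -mulN1r; apply: exp_coef_graded Gv => n {}d {}v Gv.
apply: (subspaceZ (graded_subspace _ _)).
by rewrite mulN1r; exact: lat_heis_graded.
Qed.

(** The vectors gamma + delta and gamma - delta are isotropic, with product 1/3. *)
Lemma lat_formE (x y : lat) :
  lat_form x y = (x.1 * y.2 + x.2 * y.1)%:~R / 3.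
Proof.
rewrite /lat_form big_bool /hnorm /lat_coord /= expr1 expr0.
by rewrite !(intrM, intrD, intrN); field.
Qed.

Lemma Yexp_graded al (l n : int) d be v : lat_form al be = l%:~R ->
  graded d be v -> graded (d - n - 1 - l) (be + al) (Yexp al n%:~R v).
Proof.
move=> fl Gv; apply: graded_lin_ext Gv _; first exact: graded_subspace.
move=> u du /=; apply: (subspace_fsum (graded_subspace _ _)) => -[i j] /= ij.
rewrite (_ : d - _ - _ - _ = d - j%:Z + i%:Z); last first.
  suff : (i%:Z - j%:Z + l) = - n - 1 by lia.
  by apply: (intr_inj (R := rat)); move: ij; rewrite fl !rmorphD !rmorphN /=.
apply: exp_minus_graded; apply: exp_plus_graded.
by rewrite addrC -du; exact: graded_fock.
Qed.

(* [W] has conformal weight [c] and maps charge [be] to [be + (0, 3 eps)]. *)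
Definition homogeneous (eps c : int) (W : rat -> VL F -> VL F) : Prop :=
  forall (n d p q : int) v, graded d (p, q) v ->
    graded (d - n - 1 + c - eps * p) (p, q + 3 * eps) (W n%:~R v).

Lemma Yexp_homogeneous eps : homogeneous eps 0 (@Yexp F (0, 3 * eps)).
Proof.
move=> n d p q v Gv.
have fE : lat_form (0, 3 * eps) (p, q) = (eps * p)%:~R.
  by rewrite lat_formE /= mul0r add0r !intrM; field.
have := Yexp_graded (n := n) fE Gv.
by rewrite addr0 (_ : _ + (0, _) = (p, q + 3 * eps)) //; congr pair; rewrite addr0.
Qed.

(** The m-th derivative of b(z) has conformal weight m + 1, and b(z) preserves the charge. *)
Lemma normal_prod_homogeneous eps c b (m : nat) W : homogeneous eps c W ->
  homogeneous eps (c + m.+1%:Z) (normal_prod (b, m) W).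
Proof.
move=> hW n d p q v Gv; rewrite /normal_prod /=.
apply: (subspace_fsum (graded_subspace _ _)) => k _.
apply: (subspaceZ (graded_subspace _ _)).
have -> : n%:~R - k%:~R - 1 - m%:R = (n - k - 1 - m%:Z)%:~R :> rat.
  by rewrite !intrD !intrN.
case: ifP => _.
  have := hW (n - k - 1 - m%:Z) d p q v Gv; move=> /(heis_graded (b := b) (n := k)).
  by rewrite (_ : _ - k = d - n - 1 + (c + m.+1) - eps * p); last lia.
have := hW (n - k - 1 - m%:Z) _ p q _ (heis_graded (b := b) (n := k) Gv).
by rewrite (_ : _ - _ + c - _ = d - n - 1 + (c + m.+1) - eps * p); last lia.
Qed.

End Grading.

(** * The action of e, f and h on V_L *)

Section Generators.
Variable F : numFieldType.

Lemma heis_linear b n : linear (@heis F b n).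
Proof. exact: lin_ext_linear. Qed.

Lemma lat_heis_linear al n : linear (@lat_heis F al n).
Proof.
move=> t u v; rewrite /lat_heis scaler_sumr -big_split; apply: eq_bigr => b _ /=.
by rewrite heis_linear scalerDr !scalerA mulrC.
Qed.

Lemma Yexp_linear al r : linear (@Yexp F al r).
Proof. exact: lin_ext_linear. Qed.

Lemma YL_fock u be r w :
  YL (fock_vec F u be) r w = foldr (@normal_prod F) (Yexp be) (enum_mset u) r w.
Proof.
exact: (lin_ext_fock (fun i => foldr (@normal_prod F) (Yexp i.2) (enum_mset i.1) r w)).
Qed.

Lemma YL_linear r w : linear (fun v : VL F => YL v r w).
Proof.
exact: (lin_ext_linear (fun i => foldr (@normal_prod F) (Yexp i.2) (enum_mset i.1) r w)).
Qed.

Lemma VL_act_e n w : VL_act sl_e n w = @Yexp F (0, 3) n%:~R w.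
Proof. by rewrite /VL_act /= YL_fock enum_mset0. Qed.

Lemma fock_heisN b n u be :
  heis b (- n.+1%:Z) (fock_vec F u be) = fock_vec F ((b, n) +` u)%mset be.
Proof. by rewrite -NegzE /heis lin_ext_fock. Qed.

Lemma heis0_fock b u be :
  heis b 0 (fock_vec F u be) = (hnorm F b * (lat_coord be b)%:~R) *: fock_vec F u be.
Proof. by rewrite /heis lin_ext_fock. Qed.

Lemma expL_graded be : graded 0 be (expL F be).
Proof. by rewrite -[0]/(0%N%:Z) -mset_weight0; exact: graded_fock. Qed.

Lemma exp_plus_expL al j be : (0 < j)%N -> exp_plus al j (expL F be) = 0.
Proof.
move=> j0; apply: (graded_neg _ (exp_plus_graded (expL_graded (be := be)))).
by rewrite sub0r; lia.
Qed.

Lemma exp_plus0 al (v : VL F) : exp_plus al 0 v = v.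
Proof. exact: exp_coef0. Qed.

Lemma exp_minus_0 al i : exp_minus al i (0 : VL F) = 0.
Proof.
rewrite /exp_minus /exp_coef big1 // => k _; rewrite pow_coef0 ?scaler0 // => n.
by rewrite (linear_fun0 (lat_heis_linear _ _)) scaler0.
Qed.

Lemma exp_minus0 al (v : VL F) : exp_minus al 0 v = v.
Proof. exact: exp_coef0. Qed.

(* The constraint on [(i, j)] in [Yexp] when the power of z is an integer. *)
Lemma Yexp_index (i j : nat) (l n : int) :
  (i%:R - j%:R + l%:~R = - n%:~R - 1 :> rat) <-> (i%:Z - j%:Z + l = - n - 1).
Proof.
rewrite (_ : i%:R - j%:R + l%:~R = (i%:Z - j%:Z + l)%:~R); last by rewrite intrD intrB.
rewrite (_ : - n%:~R - 1 = (- n - 1)%:~R); last by rewrite intrB intrN.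
by split=> [/intr_inj|->].
Qed.

(** Annihilation operators kill e^be, so only j = 0 contributes, and the power of z then determines
    i. *)
Lemma Yexp_expL al be (l n : int) : lat_form al be = l%:~R -> n <= - l - 1 ->
  Yexp al n%:~R (expL F be) = exp_minus al (absz (- l - 1 - n)%R) (expL F (al + be)).
Proof.
move=> fl nl; rewrite /Yexp lin_ext_fock /= fl.
rewrite (fsbigE [:: (absz (- l - 1 - n)%R, 0%N)]) //=.
- by rewrite big_cons big_nil mem_set ?addr0 ?exp_plus0 //=; apply/Yexp_index; lia.
- by move=> p /=; rewrite inE => /eqP -> /=; apply/Yexp_index; lia.
- move=> [i j] /= /Yexp_index ij; rewrite inE => /negP ijN.
  case: j ij ijN => [|j] ij ijN.
    by case: ijN; apply/eqP; congr pair; lia.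
  by rewrite exp_plus_expL // exp_minus_0.
Qed.

(** Since -6 gamma pairs to -3 with 3 (gamma + delta), the mode of index 0 picks the coefficient of
    z^2 in the creation exponential, namely (-6 gamma(-2)) / 2 + (-6 gamma(-1))^2 / 2. *)
Lemma QL_expL : QL (expL F (3, 0)) =
  18 *: fock_vec F ((false, 0%N) +` ((false, 0%N) +` mset0))%mset (0, -3)
  - 3 *: fock_vec F ((false, 1%N) +` mset0)%mset (0, -3).
Proof.
have fE : lat_form (-3, -3) (3, 0) = (-3)%:~R by rewrite lat_formE /= mulr0 add0r; field.
have := Yexp_expL (n := 0) fE isT; rewrite mulr0z /QL YL_fock enum_mset0 /= => ->.
rewrite /exp_minus exp_coef2 => [|n]; last first.
  by rewrite (linear_fun0 (lat_heis_linear _ _)) scaler0.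
have hE n (v : VL F) : lat_heis (-3, -3) n v = (-6) *: heis false n v.
  by rewrite /lat_heis big_bool /lat_coord /= subrr scale0r add0r.
have -> : ((-3, -3) : lat) + (3, 0) = (0, -3) by [].
rewrite !hE /expL (fock_heisN false 1) (fock_heisN false 0).
do 2 rewrite (linear_funZ (heis_linear false _)).
rewrite (fock_heisN false 0) !scalerA [LHS]addrC -[- (3 *: _)]scaleNr.
apply: addr_eq.
  by apply: scaler_eq; field.
by apply: scaler_eq; field.
Qed.

(** For a multiset in the form [msetn], [enum_mset] is explicit. *)
Lemma mset2E (K : choiceType) (x : K) : (x +` (x +` mset0) = msetn 2 x)%mset.
Proof. by apply/msetP => y; rewrite !mset1DE mset0E msetnE; case: (y == x). Qed.

Lemma mset1E (K : choiceType) (x : K) : (x +` mset0 = msetn 1 x)%mset.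
Proof. by apply/msetP => y; rewrite !mset1DE mset0E msetnE; case: (y == x). Qed.

(** The field of gamma(-1)^2 e^{-3 (gamma - delta)}; [f_deriv] is that of gamma(-2) e^{-3 (gamma -
    delta)}. *)
Definition f_square : rat -> VL F -> VL F :=
  normal_prod (false, 0%N) (normal_prod (false, 0%N) (Yexp (0, -3))).

Definition f_deriv : rat -> VL F -> VL F := normal_prod (false, 1%N) (Yexp (0, -3)).

Lemma sl2_vec_fE : sl2_vec F sl_f =
  -4 *: fock_vec F ((false, 0%N) +` ((false, 0%N) +` mset0))%mset (0, -3)
  + (2 / 3) *: fock_vec F ((false, 1%N) +` mset0)%mset (0, -3).
Proof.
rewrite -[LHS]/(- (2 / 9) *: QL (expL F (3, 0))) QL_expL.
move: (fock_vec F _ _) (fock_vec F _ _) => X Y.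
rewrite scalerBr !scalerA -scaleNr; apply: addr_eq.
  by apply: scaler_eq; field.
by apply: scaler_eq; field.
Qed.

Lemma YL_f_square r w :
  YL (fock_vec F ((false, 0%N) +` ((false, 0%N) +` mset0))%mset (0, -3)) r w = f_square r w.
Proof. by rewrite YL_fock mset2E enum_msetn. Qed.

Lemma YL_f_deriv r w :
  YL (fock_vec F ((false, 1%N) +` mset0)%mset (0, -3)) r w = f_deriv r w.
Proof. by rewrite YL_fock mset1E enum_msetn. Qed.

Lemma VL_act_f n w :
  VL_act sl_f n w = -4 *: f_square n%:~R w + (2 / 3) *: f_deriv n%:~R w.
Proof.
have comb c c' (X Y : VL F) :
    YL (c *: X + c' *: Y) n%:~R w = c *: YL X n%:~R w + c' *: YL Y n%:~R w.
  by have lYL := YL_linear n%:~R w; rewrite lYL (linear_funZ lYL).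
by rewrite /VL_act sl2_vec_fE comb -YL_f_square -YL_f_deriv.
Qed.

Lemma Yexp0 r (v : VL F) : Yexp (0, 0) r v = if r == -1 then v else 0.
Proof.
have exp0 (i : nat) (x : nat -> VL F -> VL F) w :
    (forall n w, x n w = 0) -> exp_coef x i w = if i == 0%N then w else 0.
  move=> x0; rewrite (exp_coef_truncated (z := 0)) ?if_same // => n _.
  by rewrite if_same.
have lh0 n (w : VL F) : lat_heis (0, 0) n w = 0.
  by rewrite /lat_heis big1 // => -[] _; rewrite /lat_coord /= ?subrr scale0r.
apply: (fock_ind (P := [set v | Yexp (0, 0) r v = if r == -1 then v else 0])).
  split=> [|t u w /= uE wE] /=; first by rewrite (linear_fun0 (Yexp_linear _ _)) if_same.
  by rewrite Yexp_linear uE wE; case: ifP => // _; rewrite scaler0 addr0.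
move=> [u be] _ /=; rewrite /Yexp lin_ext_fock /=.
have AE i j : exp_minus (0, 0) i (exp_plus (0, 0) j (fock_vec F u ((0, 0) + be)))
    = if (i == 0%N) && (j == 0%N) then fock_vec F u be else 0.
  have -> : (0, 0) + be = be by exact: add0r.
  rewrite /exp_minus /exp_plus !exp0; try by move=> n w; rewrite lh0 scaler0.
  by case: eqP; case: eqP.
have fE : lat_form (0, 0) be = 0 by rewrite lat_formE /= !mul0r.
rewrite fE; case: eqP => [->|rN].
  rewrite (fsbigE [:: (0, 0)%N]) //=.
  - by rewrite big_cons big_nil mem_set ?AE ?addr0.
  - by move=> p /=; rewrite inE => /eqP ->.
  - move=> [i j] /= _; rewrite inE AE => /negPf.
    by rewrite xpair_eqE => ->.
apply: fsbig1 => -[i j] /= ij; rewrite AE.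
case: i ij => // ; case: j => //= ij; case: rN.
by apply/eqP; rewrite -subr_eq0 opprK -oppr_eq0 opprD -ij.
Qed.

Lemma VL_act_h n w : VL_act sl_h n w = 4 *: @heis F true n w.
Proof.
rewrite /VL_act /= (linear_funZ (YL_linear n%:~R w)); congr (_ *: _).
rewrite /expL (fock_heisN true 0) YL_fock mset1E enum_msetn /= /normal_prod /=.
(* The only nonzero mode of the vacuum field has index -1, which selects k = n in the normal ordered
   product. *)
have tE (k : int) : (n%:~R - k%:~R - 1 - 0%N%:R == -1 :> rat) = (k == n).
  by rewrite -subr_eq0 subr0 opprK subrK subr_eq0 eqr_int eq_sym.
rewrite (fsbigE [:: n]) //.
  rewrite big_cons big_nil in_setT [LHS]addr0 binzn0 scale1r !Yexp0 tE eqxx.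
  by case: ifP.
move=> k _; rewrite inE => /negPf kn; rewrite binzn0 scale1r !Yexp0 tE kn.
by case: ifP => // _; exact: (linear_fun0 (heis_linear _ _)).
Qed.

Lemma VL_act_e_graded (n d p q : int) (v : VL F) : graded d (p, q) v ->
  graded (d - n - 1 - p) (p, q + 3) (VL_act sl_e n v).
Proof.
move=> Gv; rewrite VL_act_e.
have := Yexp_homogeneous (eps := 1) (n := n) Gv.
by rewrite !mul1r addr0 mulr1.
Qed.

(** The factors gamma(-1)^2 and gamma(-2) both add 2 to the conformal weight. *)
Lemma VL_act_f_graded (n d p q : int) (v : VL F) : graded d (p, q) v ->
  graded (d - n + 1 + p) (p, q - 3) (VL_act sl_f n v).
Proof.
move=> Gv; rewrite VL_act_f.
have H0 := Yexp_homogeneous (F := F) (eps := -1).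
have H1 := normal_prod_homogeneous (b := false) (m := 0) H0.
have H2 := normal_prod_homogeneous (b := false) (m := 0) H1 (n := n) Gv.
have H3 := normal_prod_homogeneous (b := false) (m := 1) H0 (n := n) Gv.
apply: (subspaceD (graded_subspace _ _ _)); apply: (subspaceZ (graded_subspace _ _ _)).
  by move: H2; rewrite (_ : _ - _ = d - n + 1 + p) // ; lia.
by move: H3; rewrite (_ : _ - _ = d - n + 1 + p) // ; lia.
Qed.

Lemma VL_act_h_graded (n d : int) be (v : VL F) : graded d be v ->
  graded (d - n) be (VL_act sl_h n v).
Proof.
move=> Gv; rewrite VL_act_h; apply: (subspaceZ (graded_subspace _ _ _)).
exact: heis_graded.
Qed.

End Generators.

(** * Extremal modes on the vectors e^beta *)

Section TopMode.
Variable F : numFieldType.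

(** Scalars pass through the sum in [normal_prod] unconditionally; additivity would require its
    supports to be finite. *)
Definition scalable_modes (W : rat -> VL F -> VL F) : Prop :=
  forall r c v, W r (c *: v) = c *: W r v.

Lemma Yexp_scalable al : scalable_modes (Yexp al).
Proof. by move=> r c v; exact: (linear_funZ (Yexp_linear al r)). Qed.

Lemma normal_prod_scalable bm W : scalable_modes W -> scalable_modes (normal_prod bm W).
Proof.
move=> sW r c v; rewrite /normal_prod scaler_fsumr; apply: eq_fsbigr => k _.
have hZ b n u : heis b n (c *: u) = c *: heis b n u :> VL F.
  exact: (linear_funZ (heis_linear b n)).
rewrite [RHS]scalerA [c * _]mulrC -[RHS]scalerA; congr (_ *: _).
by case: ifP => _; rewrite ?sW ?hZ ?sW.
Qed.

(* [c - 1 - eps * p] is the last mode of [W] that can be nonzero on [expL (p, q)]. *)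
Lemma normal_prod_expL eps c b (m : nat) W (p q : int) :
  homogeneous eps c W -> scalable_modes W ->
  normal_prod (b, m) W (c + m.+1%:Z - 1 - eps * p)%:~R (expL F (p, q)) =
  (binz F (-1) m * (hnorm F b * (lat_coord (p, q) b)%:~R)) *:
    W (c - 1 - eps * p)%:~R (expL F (p, q)).
Proof.
move=> hW sW; rewrite /normal_prod /=.
have tE (k : int) : (c + m.+1%:Z - 1 - eps * p)%:~R - k%:~R - 1 - m%:R
    = (c - 1 - eps * p - k)%:~R :> rat.
  by rewrite (_ : m%:R = m%:~R) // -!intrB -[1]/(1%:~R) -!intrB; congr (_%:~R); lia.
rewrite (fsbigE [:: 0]) //.
  rewrite big_cons big_nil in_setT [LHS]addr0 tE subr0 heis0_fock sW scalerA.
  by rewrite oppr0 sub0r.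
move=> k _; rewrite inE tE => /eqP k0; case: ltrP => k0'.
  have := hW (c - 1 - eps * p - k) 0 p q _ (expL_graded (be := (p, q))).
  move=> /graded_neg ->; last by lia.
  by rewrite (linear_fun0 (heis_linear _ _)) scaler0.
have := heis_graded (b := b) (n := k) (expL_graded (F := F) (be := (p, q))).
move=> /graded_neg ->; last by lia.
by rewrite -[0](scale0r 0) sW !scale0r scaler0.
Qed.

(** In this extremal mode each gamma acts by its eigenvalue x = (p + q) / 6, and the derivative
    contributes the factor [binz F (-1) 1] = -1. The coefficient is therefore -4 x^2 - (2/3) x. *)
Lemma VL_act_f_expL (p q : int) : VL_act sl_f (1 + p) (expL F (p, q)) =
  (- ((p + q) * (p + q + 1))%:~R / 9) *: expL F (p, q - 3).
Proof.
have H0 := Yexp_homogeneous (F := F) (eps := -1).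
have s0 := Yexp_scalable (0, 3 * -1).
have H1 := normal_prod_homogeneous (b := false) (m := 0) H0.
have s1 := normal_prod_scalable (false, 0%N) s0.
have fE : lat_form (0, 3 * -1) (p, q) = (- p)%:~R.
  by rewrite lat_formE /= mul0r add0r intrM intrN; field.
have yE : Yexp (0, 3 * -1) (0 - 1 - -1 * p)%:~R (expL F (p, q)) = expL F (p, q - 3).
  rewrite (Yexp_expL F fE); last by lia.
  rewrite (_ : absz _ = 0%N) ?exp_minus0; last lia.
  by congr (expL F _); rewrite {1}/GRing.add /=; congr pair; rewrite ?add0r // addrC.
have i1 : 0 + 1%:Z + 1%:Z - 1 - -1 * p = 1 + p by lia.
have i2 : 0 + 2%:Z - 1 - -1 * p = 1 + p by lia.
have := normal_prod_expL false 0 p q H1 s1.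
rewrite (normal_prod_expL false 0 p q H0 s0) yE i1 => E1.
have := normal_prod_expL false 1 p q H0 s0.
rewrite yE i2 => E2.
rewrite VL_act_f [f_square _ _]E1 [f_deriv _ _]E2 !scalerA -scalerDl.
apply: scaler_eq; rewrite binzn0 binzn1 /hnorm /lat_coord /= expr0.
by rewrite !(intrM, intrD, intrN); field.
Qed.

Lemma VL_act_e_expL (p q : int) : VL_act sl_e (- 1 - p) (expL F (p, q)) = expL F (p, q + 3).
Proof.
rewrite VL_act_e (Yexp_expL F (l := p)); last by lia.
  rewrite (_ : absz _ = 0%N) ?exp_minus0; last lia.
  by congr (expL F _); rewrite {1}/GRing.add /=; congr pair; rewrite ?add0r // addrC.
by rewrite lat_formE /= mul0r add0r intrM; field.
Qed.

End TopMode.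

(** * Singular vectors in V_L *)

(** Removing an absent element changes nothing. In [heis_coef] this spurious preimage is harmless,
    because its multiplicity factor is 0. *)
Lemma msetB1_neq (K : choiceType) (x : K) (u v : {mset K}%mset) :
  (u `\ x)%mset = v -> u != (x +` v)%mset -> u x = 0%N.
Proof.
move=> <-; have [xu|/mset_eq0P //] := boolP (x \in u).
by rewrite msetB1K // eqxx.
Qed.

Section Shift.
Variable F : numFieldType.

(** Multiplication by e^al alone, separated from the exponentials in [Yexp]; it commutes with the
    annihilation operators. *)
Definition shift (al : lat) : VL F -> VL F :=
  lin_ext (fun i : fock_index => fock_vec F i.1 (al + i.2)).

Lemma shift_linear al : linear (shift al).
Proof. exact: lin_ext_linear. Qed.

Lemma shift_fock al u be : shift al (fock_vec F u be) = fock_vec F u (al + be).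
Proof. exact: lin_ext_fock. Qed.

Lemma shiftK al v : shift (- al) (shift al v) = v.
Proof.
apply: (fock_ind (P := [set v | shift (- al) (shift al v) = v])) => [|[u be] _] /=.
  split=> [|t u w /= uE wE] /=.
    by rewrite !(linear_fun0 (shift_linear _)).
  by rewrite !shift_linear uE wE.
by rewrite !shift_fock addKr.
Qed.

Lemma heis_shift b n al v : heis b n.+1%:Z (shift al v) = shift al (heis b n.+1%:Z v).
Proof.
apply: (fock_ind (P := [set v |
  heis b n.+1%:Z (shift al v) = shift al (heis b n.+1%:Z v)])) => [|[u be] _] /=.
  split=> [|t u w /= uE wE] /=.
    by rewrite (linear_fun0 (heis_linear _ _)) !(linear_fun0 (shift_linear _))
      (linear_fun0 (heis_linear _ _)).
  by rewrite heis_linear !shift_linear heis_linear uE wE.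
rewrite shift_fock /heis !lin_ext_fock /=.
by rewrite (linear_funZ (shift_linear _)) shift_fock.
Qed.

(** Up to a scalar, b(n+1) is the derivation with respect to the variable b(-n-1), so each
    coefficient of the image comes from a single monomial. *)
Lemma heis_coef b n v (u : {mset (bool * nat)%type}%mset) (be : lat) :
  (heis b n.+1%:Z v)@_(u, be) =
  n.+1%:R * hnorm F b * (u (b, n)).+1%:R * v@_(((b, n) +` u)%mset, be).
Proof.
pose P := [set v : VL F | (heis b n.+1%:Z v)@_(u, be) =
  n.+1%:R * hnorm F b * (u (b, n)).+1%:R * v@_(((b, n) +` u)%mset, be)].
apply: (fock_ind (P := P)) => [|[u' be'] _] /=.
  split=> [|t y z /= yE zE]; rewrite /P /=.
    by rewrite (linear_fun0 (heis_linear _ _)) !mcoeff0 mulr0.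
  by rewrite heis_linear !mcoeffD !mcoeffZ yE zE; ring.
rewrite /P /= /heis lin_ext_fock /= mcoeffZ !mcoeffU.
have [->|uN] := eqVneq u' ((b, n) +` u)%mset.
  rewrite msetD1K mset1DE eqxx add1n !xpair_eqE !eqxx /=.
  by case: eqP; rewrite ?mulr0n ?mulr0.
rewrite !xpair_eqE (negPf uN) /= mulr0n mulr0.
have [uE|_] := eqVneq (u' `\ (b, n))%mset u; last by rewrite mulr0n mulr0.
by rewrite (msetB1_neq uE uN) mulr0 mul0r.
Qed.

(** The scalar in [heis_coef] is nonzero in characteristic 0, so a monomial containing (b, n) has
    coefficient 0. *)
Lemma heis_vacuum (v : VL F) : (forall b n, heis b n.+1%:Z v = 0) ->
  forall i, i \in msupp v -> i.1 = mset0%mset.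
Proof.
move=> hv [u be] iv /=; have [//|[[b n] bu]] := mset_0Vmem u.
have := heis_coef b n v (u `\ (b, n))%mset be.
rewrite hv mcoeff0 msetB1K // => /esym/eqP.
rewrite !mulf_eq0 signr_eq0 invr_eq0 !pnatr_eq0 /= => /eqP v0.
by move: iv; rewrite -mcoeff_neq0 v0 eqxx.
Qed.

Lemma heis0_coef b (v : VL F) i :
  (heis b 0 v)@_i = hnorm F b * (lat_coord i.2 b)%:~R * v@_i.
Proof.
pose P := [set v : VL F | (heis b 0 v)@_i = hnorm F b * (lat_coord i.2 b)%:~R * v@_i].
apply: (fock_ind (P := P)) => [|[u' be'] _] /=.
  split=> [|t y z /= yE zE]; rewrite /P /=.
    by rewrite (linear_fun0 (heis_linear _ _)) !mcoeff0 mulr0.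
  by rewrite heis_linear !mcoeffD !mcoeffZ yE zE; ring.
rewrite /P /= heis0_fock mcoeffZ !mcoeffU; case: eqP => [<-//|_].
by rewrite mulr0n !mulr0.
Qed.

End Shift.

(** * Reaching a vector e^beta inside a submodule *)

Section Lowering.
Variable F : numFieldType.

(** Several weights may occur in one vector. The strict bound makes N = 0 the zero space, where the
    induction of [lowering] starts. *)
Definition bounded (be : lat) (N : nat) : set (VL F) :=
  [set v | forall i, i \in msupp v -> i.2 = be /\ (mset_weight i.1 < N)%N].

Lemma bounded_subspace be N : subspace (bounded be N).
Proof.
split=> [i|t u v Gu Gv i]; first by rewrite msupp0 inE.
move=> /(fsubsetP (msuppD_le _ _)); rewrite inE => /orP[]; last exact: Gv.
by move=> /(fsubsetP (msuppZ_le _ _)); exact: Gu.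
Qed.

Lemma graded_bounded d be N v : d < N%:Z -> graded d be v -> bounded be N v.
Proof. by move=> dN Gv i /Gv[di ->]; split => //; lia. Qed.

Lemma bounded_ind be N (P : set (VL F)) v : subspace P -> bounded be N v ->
  (forall u, (mset_weight u < N)%N -> P (fock_vec F u be)) -> P v.
Proof.
move=> sP Bv Pu; apply: fock_ind => // -[u be'] /Bv[/= -> uN]; exact: Pu.
Qed.

Lemma bounded0 be v : bounded be 0 v -> v = 0.
Proof.
move=> Bv; apply: (bounded_ind (P := [set v | v = 0]) _ Bv) => //.
split=> // t u w /= -> ->; by rewrite scaler0 addr0.
Qed.

Lemma exp_minus_linear al i : linear (@exp_minus F al i).
Proof.
apply: exp_coef_linear => n t u v.
by rewrite lat_heis_linear scalerDr !scalerA mulrC.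
Qed.

Lemma exp_plus_linear al j : linear (@exp_plus F al j).
Proof.
apply: exp_coef_linear => n t u v.
by rewrite lat_heis_linear scalerDr !scalerA mulrC.
Qed.

Lemma exp_plus_bounded al be N j v : bounded be N v -> (N <= j)%N ->
  exp_plus al j v = 0.
Proof.
move=> Bv Nj; apply: (bounded_ind (P := [set v | exp_plus al j v = 0]) _ Bv) => [|u uN] /=.
  split=> [|t u w /= uE wE] /=; first exact: (linear_fun0 (exp_plus_linear _ _)).
  by rewrite exp_plus_linear uE wE scaler0 addr0.
apply: (graded_neg _ (exp_plus_graded (graded_fock (F := F) (u := u) (be := be)))).
by lia.
Qed.

Lemma shift_bounded al be N v : bounded be N v -> bounded (al + be) N (shift al v).
Proof.
move=> Bv; apply: (bounded_ind (P := [set v | bounded (al + be) N (shift al v)]) _ Bv).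
  split=> [|t u w /= uE wE] /=.
    by rewrite (linear_fun0 (shift_linear _)); exact: (bounded_subspace _ _).1.
  by rewrite shift_linear; exact: (bounded_subspace _ _).2.
move=> u uN /=; rewrite shift_fock.
apply: (graded_bounded _ (graded_fock (F := F) (u := u) (be := al + be))).
by lia.
Qed.

(** The power of z forces j = i + n + 1, and the annihilation part vanishes once j >= N, so the sum
    may stop at i < N. *)
Lemma VL_act_e_bounded p q N (n : nat) v : bounded (p, q) N v ->
  VL_act sl_e (n%:Z - p) v =
  \sum_(i < N) exp_minus (0, 3) i (exp_plus (0, 3) (i + n.+1) (shift (0, 3) v)).
Proof.
move=> Bv; rewrite VL_act_e.
pose P := [set v : VL F | Yexp (0, 3) (n%:Z - p)%:~R v =
  \sum_(i < N) exp_minus (0, 3) i (exp_plus (0, 3) (i + n.+1) (shift (0, 3) v))].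
apply: (bounded_ind (P := P) _ Bv) => [|u uN]; rewrite /P /=.
  split=> [|t y z /= yE zE] /=.
    rewrite (linear_fun0 (Yexp_linear _ _)) big1 // => i _.
    rewrite (linear_fun0 (shift_linear _)) (linear_fun0 (exp_plus_linear _ _)).
    exact: (linear_fun0 (exp_minus_linear _ _)).
  rewrite Yexp_linear yE zE scaler_sumr -big_split; apply: eq_bigr => i _ /=.
  by rewrite shift_linear exp_plus_linear exp_minus_linear.
rewrite shift_fock /Yexp lin_ext_fock /=.
have -> : lat_form (0, 3) (p, q) = p%:~R by rewrite lat_formE /= mul0r add0r intrM; field.
have inj : injective (fun i : nat => (i, i + n.+1)%N) by move=> i j [].
rewrite (fsbigE [seq (i, i + n.+1)%N | i <- iota 0 N]) //=.
- rewrite big_map -{1}[N]subn0 -/(index_iota 0 N) big_mkord.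
  by apply: eq_bigl => i; apply/mem_set => /=; apply/Yexp_index; lia.
- by rewrite map_inj_uniq // iota_uniq.
- by move=> x /= /mapP[i _ ->] /=; apply/Yexp_index; lia.
- move=> [i j] /= /Yexp_index ij /negP ijN.
  have [iN|Ni] := ltnP i N.
    by case: ijN; apply/mapP; exists i; [rewrite mem_iota|congr pair; lia].
  have Bu : bounded ((0, 3) + (p, q)) N (fock_vec F u ((0, 3) + (p, q))).
    have Gu := graded_fock (F := F) (u := u) (be := (0, 3) + (p, q)).
    by apply: (graded_bounded _ Gu); lia.
  by rewrite (exp_plus_bounded _ Bu) ?exp_minus_0 //; lia.
Qed.

(* The vanishing of the modes [e_(n-p)], [n >= 0], kills all the coefficients of
   positive index of [exp_plus], hence the Heisenberg modes of [3 (gamma - delta)]. *)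
Lemma singular_vacuum p q N v : bounded (p, q) N v ->
    (forall n : nat, VL_act sl_e (n%:Z - p) v = 0) ->
    (forall n : nat, heis true n.+1%:Z v = 0) ->
  forall i, i \in msupp v -> i.1 = mset0%mset.
Proof.
move=> Bv ev hv; apply: heis_vacuum => -[|] n; first exact: hv.
set w := shift (0, 3) v.
have Bw : bounded ((0, 3) + (p, q)) N w := shift_bounded (al := (0, 3)) Bv.
(* Descending induction on j, with t bounding N - j: the equation for e_(j-1-p) has [exp_plus] of
   index j as its term i = 0, and its other terms involve larger indices only. *)
have Pw t j : (0 < j)%N -> (N <= j + t)%N -> exp_plus (0, 3) j w = 0.
  elim: t j => [|t IHt] j j0 Nj; first by apply: (exp_plus_bounded _ Bw); lia.
  have [Nj'|jN] := leqP N j; first exact: exp_plus_bounded _ Bw Nj'.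
  have := ev j.-1; rewrite (VL_act_e_bounded _ Bv) -/w prednK //.
  case: (N) jN => // N' _; rewrite big_ord_recl exp_minus0 /= add0n big1 ?addr0 //.
  by move=> i _; rewrite IHt ?exp_minus_0 // /bump /=; lia.
(* Now ascending: once the smaller modes vanish on [w], [exp_plus] of index j reduces to the mode of
   index j divided by -j. *)
have lw j : (0 < j)%N -> lat_heis (0, 3) j%:Z w = 0.
  have [k] := ubnP j; elim: k j => // k IHk j jk j0.
  have := Pw N j j0 (leq_addl _ _); rewrite /exp_plus exp_coef_lead //.
  - move=> /eqP; rewrite scaler_eq0 oppr_eq0 invr_eq0 pnatr_eq0 eqn0Ngt j0 /=.
    by move=> /eqP.
  - by move=> i; rewrite (linear_fun0 (lat_heis_linear _ _)) scaler0.
  - by move=> i /andP[i0 ij]; rewrite IHk ?scaler0 //; lia.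
(* The modes of 3 gamma - 3 delta and of delta vanish, hence those of gamma. *)
have := lw n.+1 isT; rewrite /lat_heis big_bool /= heis_shift hv.
rewrite (linear_fun0 (shift_linear _)) scaler0 add0r => /eqP.
rewrite scaler_eq0 intr_eq0 /= => /eqP; rewrite heis_shift => E.
by rewrite -[LHS](shiftK (0, 3)) E (linear_fun0 (shift_linear _)).
Qed.

Variables (s : int) (J : set (VL F)).
Hypotheses (sJ : subspace J) (actJ : forall x n v, J v -> J (VL_act x n v)).

(** Each e(n-s) with n >= 0 and each h(n) with n > 0 strictly lowers the weight. Induct on the bound
    as long as one of them is nonzero on [v]; otherwise [singular_vacuum] leaves only a multiple of
    e^beta. *)
Lemma lowering N q v : J v -> bounded (s, q) N v -> v != 0 ->
  exists j : int, J (expL F (s, q + 3 * j)).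
Proof.
elim: N q v => [|N IHN] q v Jv Bv v0; first by rewrite (bounded0 Bv) eqxx in v0.
have stepB x n q' : (forall u, (mset_weight u < N.+1)%N ->
    bounded (s, q') N (VL_act x n (fock_vec F u (s, q)))) ->
    linear (VL_act (F := F) x n) -> bounded (s, q') N (VL_act x n v).
  move=> Bx lx; apply: (bounded_ind (P := [set v | bounded (s, q') N (VL_act x n v)]) _ Bv).
    split=> [|t y z /= yE zE] /=.
      by rewrite (linear_fun0 lx); exact: (bounded_subspace _ _).1.
    by rewrite lx; exact: (bounded_subspace _ _).2.
  by move=> u uN /=; exact: Bx.
have [[n /eqP en]|/forallNP ev] := pselect (exists n : nat, VL_act sl_e (n%:Z - s) v <> 0).
  have Bev : bounded (s, q + 3) N (VL_act sl_e (n%:Z - s) v).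
    apply: stepB => [u uN|]; last by move=> t y z; rewrite !VL_act_e Yexp_linear.
    apply: (graded_bounded _ (VL_act_e_graded
      (graded_fock (F := F) (u := u) (be := (s, q))))).
    by lia.
  have [j Jj] := IHN _ _ (actJ sl_e (n%:Z - s) Jv) Bev en.
  by exists (1 + j); rewrite mulrDr mulr1 addrA.
have [[n /eqP hn]|/forallNP hv] := pselect (exists n : nat, VL_act sl_h n.+1%:Z v <> 0).
  apply: (IHN q _ (actJ sl_h n.+1%:Z Jv) _ hn).
  apply: stepB => [u uN|]; last first.
    by move=> t y z; rewrite !VL_act_h heis_linear scalerDr !scalerA mulrC.
  apply: (graded_bounded _ (VL_act_h_graded
    (graded_fock (F := F) (u := u) (be := (s, q))))).
  by lia.
have ev' (n : nat) : VL_act sl_e (n%:Z - s) v = 0 by apply: contrapT; exact: ev.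
have hv' (n : nat) : heis true n.+1%:Z v = 0.
  have hv0 : VL_act sl_h n.+1%:Z v = 0 by apply: contrapT; exact: hv.
  have four_neq0 : 4 != 0 :> F by rewrite pnatr_eq0.
  by rewrite -[LHS](scalerK four_neq0) -VL_act_h hv0 scaler0.
have vE i : i \in msupp v -> i = (mset0%mset, (s, q)).
  move=> iv; have [/= i2 _] := Bv i iv.
  by rewrite (surjective_pairing i) i2 (singular_vacuum Bv ev' hv' iv).
exists 0; rewrite mulr0 addr0.
have vE' : v = v@_((mset0%mset, (s, q)) : fock_index) *: expL F (s, q).
  apply/malgP => i; rewrite mcoeffZ mcoeffU; case: eqP => [<-|iN].
    by rewrite mulr1.
  rewrite mulr0; apply/eqP; rewrite mcoeff_eq0; apply/negP => /vE iE.
  by apply: iN; rewrite iE.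
have c0 : v@_((mset0%mset, (s, q)) : fock_index) != 0.
  by apply: contraNneq v0 => c0; rewrite vE' c0 scale0r.
have := subspaceZ sJ (v@_((mset0%mset, (s, q)) : fock_index))^-1 Jv.
by rewrite {2}vE' scalerA mulVf // scale1r.
Qed.

(** With the first coordinate fixed, the eigenvalue of h(0) determines the charge. Subtracting the
    eigenvalue at [i0] removes that charge from the support and creates no new one; if nothing
    remains, there was a single charge. *)
Lemma charge_separation v : J v -> v != 0 -> (forall i, i \in msupp v -> i.2.1 = s) ->
  exists w q N, [/\ J w, w != 0, bounded (s, q) N w
    & exists2 i, i \in msupp v & i.2 = (s, q)].
Proof.
have [n] := ubnP #|` msupp v|; elim: n v => // n IHn v vn Jv v0 vs.
have /fset0Pn[i0 i0v] : msupp v != fset0.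
  apply: contraNneq v0 => sv0; apply/eqP/malgP => i.
  by rewrite mcoeff0; apply/eqP; rewrite mcoeff_eq0 sv0 inE.
pose lam (i : fock_index) : F := 4 * (hnorm F true * (lat_coord i.2 true)%:~R).
pose w := VL_act sl_h 0 v - lam i0 *: v.
have wE i : w@_i = (lam i - lam i0) * v@_i.
  by rewrite /w VL_act_h mcoeffB !mcoeffZ heis0_coef /lam; ring.
have wv : (msupp w `<=` msupp v)%fset.
  apply/fsubsetP => i; rewrite -!mcoeff_neq0 wE; apply: contraNN => /eqP ->.
  by rewrite mulr0.
have i0w : i0 \notin msupp w by rewrite -mcoeff_eq0 wE subrr mul0r.
have Jw : J w by apply: (subspaceB sJ); [exact: actJ|exact: subspaceZ].
have [w0|w0] := eqVneq w 0; last first.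
  have wn : (#|` msupp w| < n)%N.
    rewrite -ltnS; apply: leq_trans vn; rewrite ltnS; apply: fproper_ltn_card.
    by rewrite fproperEneq wv andbT; apply: contraNneq i0w => ->.
  have ws i : i \in msupp w -> i.2.1 = s by move=> /(fsubsetP wv); exact: vs.
  have [w' [q [N [Jw' w'0 Bw' [i iw iE]]]]] := IHn w wn Jw w0 ws.
  by exists w', q, N; split=> //; exists i => //; exact: (fsubsetP wv).
pose N := (\max_(i <- msupp v) mset_weight i.1).+1.
exists v, i0.2.2, N; split=> //; last first.
  by exists i0 => //; rewrite [LHS]surjective_pairing vs.
move=> i iv; split; last first.
  by rewrite ltnS; apply: (leq_bigmax_seq (F := fun i => mset_weight i.1)).
rewrite [LHS]surjective_pairing vs //; congr pair.
have /eqP := wE i; rewrite w0 mcoeff0 eq_sym mulf_eq0 mcoeff_eq0 iv orbF.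
rewrite subr_eq0 /lam => /eqP.
have four_neq0 : 4 != 0 :> F by rewrite pnatr_eq0.
have hnorm_neq0 : hnorm F true != 0.
  by rewrite mulf_neq0 ?signr_eq0 // invr_eq0 pnatr_eq0.
move=> /(mulfI four_neq0) /(mulfI hnorm_neq0) /eqP.
rewrite eqr_int /lat_coord /= (vs i iv) (vs i0 i0v) => /eqP.
by move=> /addrI /oppr_inj.
Qed.

End Lowering.

(** * The twisted span of the lattice vector *)

Section Sector.
Variables (F : numFieldType) (s m : int).
Hypothesis comm : affine_comm (- (4 / 3)) (@VL_act F).

Let T := twist_act (- (4 / 3)) s (@VL_act F).
Let w : VL F := expL F (s, m - s).

(** The eigenvalue of the operator d for the twisted action. The term in q offsets the p-dependent
    part of the weight change under e(n-s) and f(n+s), leaving n; the constant gives [w] degree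
    0. *)
Definition degree_value (d p q : int) : F :=
  - d%:~R - (q * (p + 1 - s))%:~R / 3 + (m - s)%:~R / 3.

Definition degree : VL F -> VL F :=
  lin_ext (fun i => degree_value (mset_weight i.1) i.2.1 i.2.2 *: fock_vec F i.1 i.2).

Lemma degree_linear : linear degree.
Proof. exact: lin_ext_linear. Qed.

Lemma degree_graded d p q v : graded d (p, q) v -> degree v = degree_value d p q *: v.
Proof.
move=> Gv; pose P := [set v | degree v = degree_value d p q *: v].
have sP : subspace P.
  split=> [|t y z /= yE zE]; rewrite /P /=.
    by rewrite scaler0 (linear_fun0 degree_linear).
  by rewrite degree_linear yE zE scalerDr !scalerA mulrC.
apply: (fock_ind sP) => -[u be] /Gv[/= ud ->].
by rewrite /P /= /degree lin_ext_fock /= ud.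
Qed.

Let lin_act x n : linear (@VL_act F x n).
Proof. exact: comm.1. Qed.

Lemma degree_act (A : VL F -> VL F) (t : F) : linear A ->
    (forall u p q, exists d' p' q', graded d' (p', q') (A (fock_vec F u (p, q))) /\
       degree_value d' p' q' = degree_value (mset_weight u) p q + t) ->
  forall v, degree (A v) - A (degree v) = t *: A v.
Proof.
move=> lA GA v; pose P := [set v | degree (A v) - A (degree v) = t *: A v].
have sP : subspace P.
  split=> [|c y z /= yE zE]; rewrite /P /=.
    rewrite (linear_fun0 degree_linear) (linear_fun0 lA).
    by rewrite (linear_fun0 degree_linear) subr0 scaler0.
  rewrite degree_linear !lA degree_linear opprD addrACA -scalerBr yE zE.
  by rewrite [RHS]scalerDr !scalerA mulrC.
apply: (fock_ind sP) => -[u [p q]] _; rewrite /P /=.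
have [d' [p' [q' [Gd dE]]]] := GA u p q.
rewrite (degree_graded Gd) (degree_graded (graded_fock (F := F) (u := u) (be := (p, q)))).
by rewrite (linear_funZ lA) dE scalerDl addrAC subrr add0r.
Qed.

Lemma degree_twist x n v : degree (T x n v) - T x n (degree v) = n%:~R *: T x n v.
Proof.
have act_deg : degree (VL_act x (n + twist_shift s x) v)
    - VL_act x (n + twist_shift s x) (degree v)
    = n%:~R *: VL_act x (n + twist_shift s x) v.
  apply: degree_act => // u p q.
  have Gu := graded_fock (F := F) (u := u) (be := (p, q)).
  case: x => /=.
  - do 3 eexists; split; first exact: VL_act_e_graded Gu.
    by rewrite /degree_value !(intrD, intrM, intrN); field.
  - do 3 eexists; split; first exact: VL_act_f_graded Gu.
    by rewrite /degree_value !(intrD, intrM, intrN); field.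
  - do 3 eexists; split; first exact: VL_act_h_graded Gu.
    by rewrite /degree_value !(intrD, intrM, intrN); field.
(* The twisting scalar occurs only at n = 0, where the commutator with d must vanish. *)
have nc : n%:~R * twist_const (- (4 / 3) : F) s x n = 0.
  by case: x {act_deg} => /=; rewrite ?mulr0 //; case: eqP => [->|_]; rewrite ?mul0r ?mulr0.
rewrite /T /twist_act (linear_funD degree_linear) (linear_funZ degree_linear).
by rewrite opprD addrACA subrr addr0 act_deg scalerDr scalerA nc scale0r addr0.
Qed.

Hypothesis m01 : m * (m + 1) = 0.

(** All modes of n_+ send [w] to negative weight, except the twisted f(1), which is f(1+s) and
    yields a vector e^beta with a coefficient proportional to m (m + 1). *)
Lemma sector_hw : highest_weight_vector (- (4 / 3) - 2 * m%:~R / 3) (2 * m%:~R / 3) T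
  ( *:%R (- (4 / 3))) degree w.
Proof.
have Gw : graded 0 (s, m - s) w := expL_graded (F := F) (be := (s, m - s)).
have w0 x (d' : int) be n : d' < 0 -> graded d' be (VL_act (F := F) x n w) ->
    VL_act x n w = 0.
  by move=> d0 G; exact: graded_neg d0 G.
split.
- apply: contraTneq isT => wz.
  have := congr1 (mcoeff ((mset0%mset, (s, m - s)) : fock_index)) wz.
  by rewrite mcoeffUU mcoeff0 => /eqP; rewrite oner_eq0.
- split=> [|x n n0]; rewrite /T /twist_act /=.
    rewrite scale0r addr0; apply: (w0 _ _ _ _ _ (VL_act_e_graded Gw)); lia.
  have -> : twist_const (- (4 / 3) : F) s x n = 0.
    by case: x => //=; rewrite gt_eqF.
  rewrite scale0r addr0; case: x => /=.
  + by apply: (w0 _ _ _ _ _ (VL_act_e_graded Gw)); lia.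
  + have [n1|n1] := eqVneq n 1; last first.
      by apply: (w0 _ _ _ _ _ (VL_act_f_graded Gw)); lia.
    rewrite n1 VL_act_f_expL (_ : s + (m - s) = m) ?m01 ?oppr0 ?mul0r ?scale0r //; lia.
  + by apply: (w0 _ _ _ _ _ (VL_act_h_graded Gw)); lia.
- rewrite /T /twist_act /= addr0 VL_act_h heis0_fock scalerA -scalerDl.
  apply: scaler_eq; rewrite /hnorm /lat_coord /= expr1.
  by rewrite !(intrD, intrM, intrN); field.
- by apply: scaler_eq; rewrite subrK.
- rewrite (degree_graded Gw) (_ : degree_value _ _ _ = 0) ?scale0r //.
  by rewrite /degree_value !(intrD, intrM, intrN); field.
Qed.

(** As e and f change the second coordinate by 3 and -3, the span of [w] stays here; so [lowering]
    ends at some e^beta differing from [w] by a power of e^{3 (gamma - delta)}. *)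
Definition sector : set (VL F) :=
  [set v | forall i, i \in msupp v -> i.2.1 = s /\ exists j : int, i.2.2 = m - s + 3 * j].

Lemma sector_subspace : subspace sector.
Proof.
split=> [i|t u v Gu Gv i]; first by rewrite msupp0 inE.
move=> /(fsubsetP (msuppD_le _ _)); rewrite inE => /orP[]; last exact: Gv.
by move=> /(fsubsetP (msuppZ_le _ _)); exact: Gu.
Qed.

Lemma sector_graded d j v : graded d (s, m - s + 3 * j) v -> sector v.
Proof. by move=> Gv i /Gv[_ ->]; split=> //; exists j. Qed.

Lemma sector_submodule : submodule T sector.
Proof.
have [S0 SL] := sector_subspace; split=> // x n v Sv.
rewrite /T /twist_act addrC; apply: (SL) => //.
pose P := [set v | sector (VL_act x (n + twist_shift s x) v)].
have sP : subspace P.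
  split=> [|c y z /= yE zE]; rewrite /P /=; first by rewrite (linear_fun0 (lin_act _ _)).
  by rewrite lin_act; exact: SL.
apply: (fock_ind sP) => -[u [p q]] /Sv[/= -> [j ->]]; rewrite /P /=.
have Gu := graded_fock (F := F) (u := u) (be := (s, m - s + 3 * j)).
case: x {P sP} => /=.
- apply: (sector_graded (j := j + 1)).
  rewrite mulrDr mulr1 addrA; exact: VL_act_e_graded Gu.
- apply: (sector_graded (j := j - 1)).
  rewrite mulrBr mulr1 addrA; exact: VL_act_f_graded Gu.
- apply: (sector_graded (j := j)); exact: VL_act_h_graded Gu.
Qed.

Lemma sector_simple (J : set (VL F)) : submodule T J -> J `<=` affine_span T w ->
  (exists2 x, J x & x != 0) -> J w.
Proof.
move=> subJ Jw [x Jx x0]; have sJ := submodule_subspace subJ.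
have actJ y n v : J v -> J (VL_act y n v).
  case: (subJ) => _ _ Tact Jv.
  have := subspaceB sJ (Tact y (n - twist_shift s y) v Jv)
    (subspaceZ sJ (twist_const (- (4 / 3)) s y (n - twist_shift s y)) Jv).
  by rewrite /T /twist_act addrK subrK.
have xS : sector x.
  apply: (affine_span_min sector_submodule) (Jw x Jx).
  by apply: (sector_graded (j := 0)); rewrite mulr0 addr0; exact: expL_graded.
have xs i : i \in msupp x -> i.2.1 = s by move=> /xS[].
have [v [q [N [Jv v0 Bv [i ix iE]]]]] := charge_separation sJ actJ Jx x0 xs.
have [_ [j0 qE]] := xS i ix; rewrite iE /= in qE.
have [j] := lowering sJ actJ Jv Bv v0; rewrite {}qE -addrA -mulrDr.
move: (j0 + j) => {}j.
have up t : J (expL F (s, t)) -> J (expL F (s, t + 3)).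
  by move=> /(actJ sl_e (- 1 - s)); rewrite VL_act_e_expL.
(* The coefficient is - x (x + 1) / 9 with x = m + 3 (n + 1), and x >= 2 because m is 0 or -1. *)
have down (n : nat) : J (expL F (s, m - s + 3 * n.+1%:Z)) ->
    J (expL F (s, m - s + 3 * n%:Z)).
  move=> /(actJ sl_f (1 + s)); rewrite VL_act_f_expL.
  set c := _ / 9; have c0 : c != 0.
    rewrite /c mulf_neq0 ?invr_eq0 ?pnatr_eq0 // oppr_eq0 intr_eq0.
    by move: m01 => /eqP; rewrite !mulf_eq0; lia.
  move=> /(subspaceZ sJ c^-1); rewrite scalerA mulVf // scale1r.
  by congr (J (expL F (_, _))); lia.
case: j => n.
  elim: n => [|n IHn]; first by rewrite mulr0 addr0.
  by move=> /down.
rewrite NegzE; elim: n => [|n IHn] /up.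
  by congr (J (expL F (_, _))); lia.
move=> Jn; apply: IHn; move: Jn.
by congr (J (expL F (_, _))); lia.
Qed.

End Sector.

(* V is L(-4/3 Lambda_0); YVL is V_L as a weak V-module; Ys, resp. Ns, is the
   image of L(-4/3 Lambda_0), resp. L(-2/3 Lambda_0 - 2/3 Lambda_1), by
   pi_(-s). *)
Theorem theorem4p3 (R : realType)
    (V : vertex_algebra R[i]) (g : sl2_basis -> V)
    (hV : is_affine_VOA (- (4 / 3)) g)
    (YVL : V -> int -> VL R[i] -> VL R[i])
    (hVL : weak_module V YVL)
    (hg : forall (x : sl2_basis) (n : int) (w : VL R[i]),
        YVL (g x) n w = VL_act x n w)
    (s : int) :
  (forall Ys : V -> int -> V -> V,
     is_pi g (- s) (@va_prod R[i] V) Ys ->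
     weak_iso_onto Ys YVL
       (affine_span (@VL_act R[i]) (expL R[i] (lat_2s_delta s))))
  /\
  (forall (N : lmodType R[i]) (YN Ns : V -> int -> N -> N),
     is_affine_module (- (2 / 3)) (- (2 / 3)) g YN ->
     is_pi g (- s) YN Ns ->
     weak_iso_onto Ns YVL
       (affine_span (@VL_act R[i]) (expL R[i] (lat_mgamma_2s1_delta s)))).
Proof.
have actE : modes g YVL = @VL_act R[i].
  by apply/funext => x; apply/funext => n; apply/funext => v; exact: hg.
(* The bracket relations and the linearity of f(n) on the Fock space are inherited from the weak
   module structure. *)
have comm : affine_comm (- (4 / 3)) (@VL_act R[i]).
  by rewrite -actE; exact: weak_module_affine_comm hV _ _ hVL.
(* The pair (s, m - s) is m gamma + (2 s - m) delta; m = 0 and m = -1 give the two claims. *)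
have main (m : int) (a b : R[i]) (M : lmodType R[i]) (YM Ms : V -> int -> M -> M) v :
    m * (m + 1) = 0 -> a = - (4 / 3) - 2 * m%:~R / 3 -> b = 2 * m%:~R / 3 ->
    weak_module V YM -> is_irreducible_hw a b (modes g YM) v -> is_pi g (- s) YM Ms ->
    weak_iso_onto Ms YVL (affine_span (@VL_act R[i]) (expL R[i] (s, m - s))).
  move=> m01 -> -> modM irrM piM; rewrite -actE.
  apply: (pi_iso hV modM hVL piM _ irrM (@degree_linear R[i] s m)).
  - by rewrite subrK.
  - by rewrite actE; exact: degree_twist.
  - by rewrite actE; exact: sector_hw.
  - by rewrite actE; exact: sector_simple.
split=> [Ys piV|N YN Ns [modN [v irrN]] piN].
  rewrite /lat_2s_delta -(sub0r s).
  apply: main (va_module V) hV piV => //; last by rewrite mulr0 mul0r.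
  by rewrite mulr0 mul0r subr0.
rewrite /lat_mgamma_2s1_delta (addrC (- s)).
by apply: main modN irrN piN => //; rewrite mulrN1z; field.
Qed.
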